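(* Let $\epsilon>0$. Let $w_1,\ldots,w_m:(-\epsilon,\epsilon)\to\mathbb C\setminus\{0\}$ and $u:(-\epsilon,\epsilon)\to\mathbb R$ be differentiable functions. Consider the equations \[\text{(A)}\quad \frac{dw_j}{dt}=a_j\,\overline{w_1\cdots w_{j-1}w_{j+1}\cdots w_m}\quad(j=1,\ldots,m),\] \[\text{(B)}\quad \frac{du}{dt}=2\,\mathrm{Re}(w_1\cdots w_m),\] \[\text{(C)}\quad |w_j|^2=a_ju+1\quad(j=1,\ldots,m).\] (i) If (A) and (B) hold for all $t\in(-\epsilon,\epsilon)$ and (C) holds at $t=0$, then (C) holds for all $t\in(-\epsilon,\epsilon)$. (ii) Suppose (A), (B) and (C) hold for all $t\in(-\epsilon,\epsilon)$. Define $N\subset\mathbb C^m$ to be the set of points $\bigl(re^{i\alpha_1}w_1(t),\ldots,re^{i\alpha_m}w_m(t)\bigr)$ with $r>0$, $t\in(-\epsilon,\epsilon)$, $\alpha_j\in\mathbb R$, $\alpha_1+\cdots+\alpha_m=0$ and $a_1\alpha_1+\cdots+a_m\alpha_m=0$. Then $N$ is a special Lagrangian submanifold of $\mathbb C^m$ with phase $i^{m-2}$.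
   Context: Standing assumptions: $m\ge3$, and $a_1\le\cdots\le a_m$ are integers, not all zero, with highest common factor $1$ and $a_1+\cdots+a_m=0$. $\mathbb C^m$ carries the metric $g=\sum_j|dz_j|^2$, the Kähler form $\omega=\frac i2\sum_j dz_j\wedge d\bar z_j$ and $\Omega=dz_1\wedge\cdots\wedge dz_m$. An oriented real $m$-dimensional submanifold $L$ is special Lagrangian with phase $e^{i\theta}$ if $(\cos\theta\,\mathrm{Re}\,\Omega+\sin\theta\,\mathrm{Im}\,\Omega)|_L$ equals the induced volume form. *)

(* Defs.v *)
From HB Require Import structures.
From mathcomp Require Import all_boot all_order all_algebra.
From mathcomp Require Import all_classical all_reals all_analysis.
From mathcomp Require Import complex.

Set Implicit Arguments.
Unset Strict Implicit.
Unset Printing Implicit Defensive.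

Import Order.TTheory GRing.Theory Num.Theory.
Import numFieldNormedType.Exports.
Local Open Scope classical_set_scope.
Local Open Scope ring_scope.

Section Defs.
Variable R : realType.

Definition reF (f : R -> R[i]) : R -> R := fun s => complex.Re (f s).
Definition imF (f : R -> R[i]) : R -> R := fun s => complex.Im (f s).

Definition cdifferentiable (f : R -> R[i]) (t : R) : Prop :=
  derivable (reF f) t 1 /\ derivable (imF f) t 1.

Definition cderive (f : R -> R[i]) (t : R) : R[i] :=
  Complex (derive1 (reF f) t) (derive1 (imF f) t).

Definition expi (a : R) : R[i] := Complex (cos a) (sin a).

Definition realify (m : nat) (z : 'I_m -> R[i]) : 'rV[R]_(m + m) :=
  \row_(k < m + m)
    match fintype.split k with
    | inl j => complex.Re (z j)
    | inr j => complex.Im (z j)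
    end.

Definition dz (m : nat) (j : 'I_m) (v : 'rV[R]_(m + m)) : R[i] :=
  Complex (v 0 (lshift m j)) (v 0 (rshift m j)).

(** Omega = dz_1 /\ ... /\ dz_m evaluated on (v_1,...,v_m) (rows of V). *)
Definition Omega (m : nat) (V : 'M[R]_(m, m + m)) : R[i] :=
  \det (\matrix_(k < m, j < m) dz j (row k V)).

(** Volume form of the induced metric g = sum |dz_j|^2 on (v_1,...,v_m)
    (positively oriented ordered basis): sqrt det of the Gram matrix. *)
Definition induced_vol (m : nat) (V : 'M[R]_(m, m + m)) : R :=
  Num.sqrt (\det (V *m V^T)).

Definition iterD (k n : nat) (l : seq 'rV[R]_k) (f : 'rV[R]_k -> 'rV[R]_n)
  : 'rV[R]_k -> 'rV[R]_n :=
  foldr (fun v g => 'D_v g) f l.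

Definition jacobian (k n : nat) (phi : 'rV[R]_k -> 'rV[R]_n) (x : 'rV[R]_k)
  : 'M[R]_(k, n) :=
  \matrix_(i < k) ('D_(delta_mx 0 i) phi x).

(** (U, V, phi) is an (oriented) local chart of the real k-dimensional
    embedded smooth submanifold S of R^n around the points of S inside U:
    V open in R^k, phi smooth on V, an immersion, and a homeomorphism of V
    onto S `&` U (with U open). *)
Definition submanifold_chart (k n : nat) (S : set 'rV[R]_n) (U : set 'rV[R]_n)
  (V : set 'rV[R]_k) (phi : 'rV[R]_k -> 'rV[R]_n) : Prop :=
  [/\ open U, open V, phi @` V = S `&` U,
      (forall x y, V x -> V y -> phi x = phi y -> x = y) &
      (forall x, V x -> forall e : R, 0 < e ->
          exists2 d : R, 0 < d &
            forall y, V y -> `|phi y - phi x| < d -> `|y - x| < e)] /\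
  (forall (l : seq 'rV[R]_k) x, V x -> differentiable (iterD l phi) x) /\
  (forall x, V x -> row_free (jacobian phi x)).

(** S is an embedded (real m-dimensional, smooth) submanifold of
    C^m = R^{2m} which admits an orientation for which it is special
    Lagrangian with phase c = e^{i theta}: it is covered by charts such that
    (cos theta Re Omega + sin theta Im Omega)|_S equals the induced volume
    form in every chart (the charts then define the orientation). *)
Definition special_lagrangian (m : nat) (c : R[i]) (S : set 'rV[R]_(m + m))
  : Prop :=
  forall p, S p ->
    exists U : set 'rV[R]_(m + m), exists V : set 'rV[R]_m,
    exists phi : 'rV[R]_m -> 'rV[R]_(m + m),
      [/\ U p, submanifold_chart S U V phi &
          forall x, V x ->
            complex.Re c * complex.Re (Omega (jacobian phi x)) + complex.Im c * complex.Im (Omega (jacobian phi x))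
            = induced_vol (jacobian phi x)].

Definition Nset (m : nat) (a : 'I_m -> int) (eps : R) (w : 'I_m -> R -> R[i])
  : set 'rV[R]_(m + m) :=
  [set p | exists r : R, exists t : R, exists al : 'I_m -> R,
     [/\ 0 < r, - eps < t < eps,
         \sum_(j < m) al j = 0,
         \sum_(j < m) (a j)%:~R * al j = 0 &
         p = realify (fun j => (r%:C * expi (al j) * w j t)%C)]].

Definition odeA (m : nat) (a : 'I_m -> int) (w : 'I_m -> R -> R[i]) (t : R) :=
  forall j : 'I_m,
    cderive (w j) t = ((a j)%:~R * conjc (\prod_(k < m | k != j) w k t))%R.

Definition odeB (m : nat) (w : 'I_m -> R -> R[i]) (u : R -> R) (t : R) :=
  derive1 u t = 2 * complex.Re (\prod_(k < m) w k t).

Definition constrC (m : nat) (a : 'I_m -> int) (w : 'I_m -> R -> R[i]) (u : R -> R)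
  (t : R) :=
  forall j : 'I_m, Normc.normc (w j t) ^+ 2 = (a j)%:~R * u t + 1.

End Defs.

(* Main.v *)
(** Split R^m orthogonally as R(1,...,1) + R a + W and write x = r (1,...,1) + t a
    + alpha accordingly; then N is the image of the open set r > 0, |t| < eps under
    phi(x)_j = r e^(i alpha_j) w_j(t).  By (A), w_j' = a_j conj(Q) w_j / |w_j|^2 with
    Q = w_1 ... w_m, so the complex Jacobian of phi is i (1 + rank one)(1 + rank one)
    times a diagonal matrix, and its determinant is i^(m-2) times a positive number;
    by (C) the tangent spaces are isotropic, hence the Gram determinant is
    |Omega|^2.  Smoothness holds because (A) makes the algebra generated by r,
    cos alpha_j, sin alpha_j, Re w_j(t) and Im w_j(t) stable under differentiation.

    N may wind around many times, so that it is embedded requires an argument: an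
    integral basis of W allows one to keep alpha bounded, and if phi(x_n) -> phi(x0)
    with x_n -> x, where t(x) may be an end point of the interval, then uniqueness
    for (A), which commutes with the rotations e^(i alpha), shows that translation
    by x0 - x preserves phi near x.  Hence all points of N near phi(x0) come from
    points near x0. *)

Require Import Defs.
From HB Require Import structures.
From mathcomp Require Import all_boot all_order all_algebra.
From mathcomp Require Import all_classical all_reals all_analysis.
From mathcomp Require Import complex.
From mathcomp Require Import ring lra.
Set Implicit Arguments.
Unset Strict Implicit.
Unset Printing Implicit Defensive.
Import Order.TTheory GRing.Theory Num.Theory.
Import numFieldNormedType.Exports.
Local Open Scope classical_set_scope.
Local Open Scope ring_scope.

(** The determinant of the block matrix [M] is computed twice, splitting off the unipotent factor
    with block [c] once on the left and once on the right. *)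
Lemma det_1Dcolrow (K : comNzRingType) n (c : 'cV[K]_n) (r : 'rV[K]_n) :
  \det (1%:M + c *m r) = 1 + (r *m c) 0 0.
Proof.
pose M : 'M[K]_(1 + n) := block_mx 1%:M (- r) c 1%:M.
transitivity (\det M).
  have -> : M = block_mx 1%:M 0 c 1%:M *m block_mx 1%:M (- r) 0 (1%:M + c *m r).
    rewrite mulmx_block !mul1mx !mulmx1 !mul0mx ?mulmx0 ?addr0 mulmxN.
    by rewrite addrCA addNr addr0.
  by rewrite det_mulmx det_lblock det_ublock !det1 !mul1r.
have -> : M = block_mx (1%:M + r *m c) (- r) 0 1%:M *m block_mx 1%:M 0 c 1%:M.
  rewrite mulmx_block !mulmx1 !mul1mx ?mulmx0 ?mul0mx ?add0r mulNmx.
  by rewrite addrK.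
rewrite det_mulmx det_ublock det_lblock !det1 !mulr1 det_mx11.
by rewrite !mxE eqxx.
Qed.

(** * Isotropic families and the calibration *)

Section ComplexRows.
Variables (R : realType) (m : nat).
Implicit Types V : 'M[R]_(m, m + m).

Lemma Re_prod_conj (z1 z2 : R[i]) :
  complex.Re (z1 * conjc z2)
  = complex.Re z1 * complex.Re z2 + complex.Im z1 * complex.Im z2.
Proof. by case: z1 => a b; case: z2 => c d /=; rewrite mulrN opprK. Qed.

Lemma Im_prod_conj (z1 z2 : R[i]) :
  complex.Im (z1 * conjc z2)
  = complex.Im z1 * complex.Re z2 - complex.Re z1 * complex.Im z2.
Proof. by case: z1 => a b; case: z2 => c d /=; rewrite mulrN addrC. Qed.

Lemma Re_sum (I : Type) (r : seq I) (P : pred I) (F : I -> R[i]) :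
  complex.Re (\sum_(i <- r | P i) F i) = \sum_(i <- r | P i) complex.Re (F i).
Proof. by apply: (big_morph (@complex.Re R)) => // -[? ?] [? ?]. Qed.

Lemma Im_sum (I : Type) (r : seq I) (P : pred I) (F : I -> R[i]) :
  complex.Im (\sum_(i <- r | P i) F i) = \sum_(i <- r | P i) complex.Im (F i).
Proof. by apply: (big_morph (@complex.Im R)) => // -[? ?] [? ?]. Qed.

Lemma gram_dz V k l :
  (V *m V^T) k l
  = \sum_(j < m) complex.Re (dz j (row k V) * conjc (dz j (row l V))).
Proof.
rewrite !mxE big_split_ord /= -big_split /=; apply: eq_bigr => j _.
by rewrite !mxE mulrN opprK.
Qed.

(* The vanishing imaginary parts say that the rows of V span an isotropic
   subspace for the Kaehler form. *)
Lemma det_gram_isotropic V :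
  (forall k l, \sum_(j < m)
     complex.Im (dz j (row k V) * conjc (dz j (row l V))) = 0) ->
  ((\det (V *m V^T))%:C)%C = Omega V * conjc (Omega V).
Proof.
move=> H; rewrite -(det_map_mx (real_complex R)) /Omega.
set Z := \matrix_(k, j) _.
rewrite -(det_map_mx (@conjc R)) -[X in _ = _ * X]det_tr -det_mulmx.
congr (\det _); apply/matrixP => k l.
rewrite [LHS]mxE gram_dz [RHS]mxE; apply/eqP; rewrite eq_complex; apply/andP.
split; apply/eqP.
  by rewrite Re_sum; apply: eq_bigr => j _; rewrite !mxE.
by rewrite /= Im_sum -[LHS](H k l); apply: eq_bigr => j _; rewrite !mxE.
Qed.

(** By isotropy the Gram determinant is [Omega V] times its conjugate, that is [s ^+ 2]. It is
    nonzero, so the rows are independent, and its root [s] is the real part of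
    [conjc c * Omega V]. *)
Lemma phase_condition V (c : R[i]) (s : R) : 0 < s -> c * conjc c = 1 ->
  (forall k l, \sum_(j < m)
     complex.Im (dz j (row k V) * conjc (dz j (row l V))) = 0) ->
  Omega V = (s%:C)%C * c ->
  row_free V /\
  complex.Re c * complex.Re (Omega V) + complex.Im c * complex.Im (Omega V)
  = induced_vol V.
Proof.
move=> s0 c1 /det_gram_isotropic Hdet HO.
have dE : \det (V *m V^T) = s ^+ 2.
  apply: (@complexI R); rewrite Hdet HO rmorphM mulrACA c1 mulr1.
  by rewrite [X in _ * X]conjc_real -rmorphM expr2.
split.
  have u : V *m V^T \in unitmx by rewrite unitmxE dE unitfE expf_neq0// gt_eqF.
  rewrite /row_free eqn_leq rank_leq_row /=.
  by rewrite -[leqLHS](mxrank_unit u) mxrankM_maxl.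
rewrite /induced_vol dE sqrtr_sqr gtr0_norm// HO.
move: c1 {HO}; case: c => x y /= [c1 _].
by transitivity (s * (x * x - y * - y)); [ring | rewrite c1 mulr1].
Qed.

End ComplexRows.

(** * Determinant and isotropy of the logarithmic Jacobian *)

Section JacobianDeterminant.
Variables (R : realType) (m : nat) (b : 'I_m -> R).
Hypothesis sb0 : \sum_j b j = 0.
Let s := \sum_j b j ^+ 2.
Hypothesis s_neq0 : s != 0.
Hypothesis m_ge3 : (3 <= m)%N.

Let mR_neq0 : m%:R != 0 :> R.
Proof. by rewrite pnatr_eq0 -lt0n (leq_trans _ m_ge3). Qed.

(** Matrix of the orthogonal projection of R^m onto W, the complement of (1,...,1) and [b], which
    are orthogonal to each other by [sb0]. *)
Definition al_coef (k j : 'I_m) : R :=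
  (j == k)%:R - m%:R^-1 - b j * b k / s.

Lemma sum_al_coef k : \sum_j al_coef k j = 0.
Proof.
rewrite /al_coef !big_split /= !sumrN -!mulr_suml sb0.
rewrite !mul0r oppr0 addr0 sumr_const card_ord -[_ *+ m]mulr_natl divff//.
rewrite (bigD1 k)//= eqxx big1 ?addr0 ?subrr// => j /negbTE -> //.
Qed.

Lemma sum_b_al_coef k : \sum_j b j * al_coef k j = 0.
Proof.
under eq_bigr do rewrite /al_coef !mulrBr.
rewrite !big_split /= !sumrN -mulr_suml sb0 mul0r subr0.
rewrite (bigD1 k)//= eqxx big1 ?addr0 => [|j /negbTE ->]; last exact: mulr0.
under eq_bigr do rewrite !mulrA -expr2.
by rewrite -!mulr_suml -/s mulrAC divff// mul1r mulr1 subrr.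
Qed.

(* [q] stands for the product of the w_j, [d j] for |w_j|^-2. *)
Definition jac_coef (r : R) (q : R[i]) (d : 'I_m -> R) (k j : 'I_m) : R[i] :=
  Complex ((r * m%:R)^-1) (al_coef k j)
  + ((b k / s * (b j * d j))%:C)%C * conjc q.

(** After [i] is factored out, what remains is the identity plus two rank one matrices. Since [b] is
    orthogonal to (1,...,1), the cross term [r1 *m c2] vanishes, so this sum is a product of two
    matrices to which [det_1Dcolrow] applies. *)
Lemma det_jac_coef (r : R) q d : r != 0 ->
  \det (\matrix_(k, j) jac_coef r q d k j) =
  (((\sum_j b j ^+ 2 * d j) / (s * r))%:C)%C * conjc q
    * (Complex 0 1 : R[i]) ^+ (m - 2).
Proof.
move=> r0.
pose i : R[i] := Complex 0 1.
have i2 : i * i = -1 by rewrite -expr2; exact: sqr_i.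
pose c1 : 'cV[R[i]]_m := const_mx 1.
pose r1 : 'rV[R[i]]_m := const_mx (- i * (((r * m%:R)^-1)%:C)%C - ((m%:R^-1)%:C)%C).
pose c2 : 'cV[R[i]]_m := \col_k ((b k)%:C)%C.
pose r2 : 'rV[R[i]]_m :=
  \row_j ((((b j / s)%:C)%C) * (- i * ((d j)%:C)%C * conjc q - 1)).
have -> : \matrix_(k, j) jac_coef r q d k j
    = i *: ((1%:M + c1 *m r1) *m (1%:M + c2 *m r2)).
  have r1c2 : r1 *m c2 = 0.
    apply/matrixP => x y; rewrite !mxE.
    under eq_bigr do rewrite !mxE.
    by rewrite -mulr_sumr -rmorph_sum sb0 rmorph0 mulr0.
  rewrite mulmxDl mul1mx mulmxDr mulmx1 -[c1 *m r1 *m _]mulmxA.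
  rewrite [r1 *m (_ *m _)]mulmxA r1c2 mul0mx mulmx0 addr0; apply/matrixP => k j.
  rewrite !mxE !big_ord1 !mxE mul1r /jac_coef /al_coef eq_sym.
  have -> : Complex ((r * m%:R)^-1) ((k == j)%:R - m%:R^-1 - b j * b k / s)
    = (((r * m%:R)^-1)%:C)%C
      + i * (((k == j)%:R)%:C)%C - i * ((m%:R^-1)%:C)%C
      - i * ((b j * b k / s)%:C)%C :> R[i].
    by apply/eqP; rewrite eq_complex /i /=; apply/andP; split; apply/eqP; ring.
  rewrite rmorph_nat !rmorphM.
  set x := ((r * _)^-1%:C)%C; set y := (m%:R^-1%:C)%C; set z := (s^-1%:C)%C.
  set bj := (b j)%:C%C; set bk := (b k)%:C%C; set dj := (d j)%:C%C.
  set Q := conjc q.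
  transitivity (- (i * i) * x + i * (k == j)%:R - i * y - i * (bj * bk * z)
     - (i * i) * (bk * z * (bj * dj) * Q)).
    by rewrite i2; ring.
  by ring.
rewrite detZ det_mulmx !det_1Dcolrow.
have -> : (r1 *m c1) 0 0 = - i * ((r^-1)%:C)%C - 1.
  rewrite !mxE; under eq_bigr do rewrite !mxE mulr1.
  rewrite sumr_const card_ord -[LHS]mulr_natl mulrBr mulrCA -!(rmorph_nat (real_complex R)).
  by rewrite -!rmorphM divff// invfM mulrCA divff// mulr1 rmorph1.
have -> : (r2 *m c2) 0 0
   = - i * conjc q * (((\sum_j b j ^+ 2 * d j) / s)%:C)%C - 1.
  rewrite !mxE; under eq_bigr do rewrite !mxE.
  have e1 : 1 = \sum_j (((b j ^+ 2 / s)%:C)%C) :> R[i].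
    by rewrite -(rmorph_sum (real_complex R)) -mulr_suml divff.
  rewrite mulr_suml (rmorph_sum (real_complex R)) mulr_sumr [X in _ = _ - X]e1.
  by rewrite -sumrB; apply: eq_bigr => j _; rewrite !expr2 !rmorphM /=; ring.
(* Each of the two factors contributes one [- i], so the total power is [i ^+ m * (- i) ^+ 2], which
   equals [i ^+ (m - 2)]. *)
rewrite -{1}(subnK (leq_trans (leqnSn 2) m_ge3)) exprD expr2 -/i i2.
rewrite !(addrC 1) !addrNK invfM !rmorphM.
rewrite /=; move: (real_complex R (\sum_j b j ^+ 2 * d j)).
move: (real_complex R s^-1) (real_complex R r^-1) => X Y A.
transitivity ((i * i) * (-1) * (i ^+ (m - 2) * (Y * conjc q * (A * X)))).
  by ring.
by rewrite i2; ring.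
Qed.

(** Here [n j] stands for |w_j|^2. The relation [n j * d j = 1] removes [d] from the mixed terms,
    and [n j = b j * u + 1] reduces the others to the sums that vanish by orthogonality. The
    remainder [F] is symmetric in [k] and [l], whereas the imaginary part is antisymmetric. *)
Lemma isotropic_jac_coef r q d n u :
  (forall j, n j = b j * u + 1) -> (forall j, n j * d j = 1) ->
  forall k l, \sum_j n j *
    complex.Im (jac_coef r q d k j * conjc (jac_coef r q d l j)) = 0.
Proof.
move=> nE nd; case: q => q1 q2.
pose x k j := (r * m%:R)^-1 + b k / s * (b j * d j) * q1.
pose y k j := al_coef k j - b k / s * (b j * d j) * q2.
have ReE k j : complex.Re (jac_coef r (Complex q1 q2) d k j) = x k j.
  by rewrite /jac_coef /x /=; ring.
have ImE k j : complex.Im (jac_coef r (Complex q1 q2) d k j) = y k j.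
  by rewrite /jac_coef /y /=; ring.
have F k l : \sum_j n j * (y k j * x l j) =
   - (b k / s * (b l / s) * q1 * q2 * \sum_j b j ^+ 2 * d j).
  transitivity (\sum_j (((r * m%:R)^-1 * u + b l / s * q1) * (b j * al_coef k j)
      + (r * m%:R)^-1 * al_coef k j
      - b k / s * q2 * (r * m%:R)^-1 * b j
      - b k / s * (b l / s) * q1 * q2 * (b j ^+ 2 * d j))).
    apply: eq_bigr => j _; rewrite /x /y.
    transitivity (n j * al_coef k j * (r * m%:R)^-1
      + (n j * d j) * (b l / s * b j * q1 * al_coef k j
      - b k / s * q2 * (r * m%:R)^-1 * b j
      - b k / s * (b l / s) * q1 * q2 * (b j ^+ 2 * d j))).
      by ring.
    by rewrite nd nE; ring.
  rewrite !big_split /= !sumrN -!mulr_sumr sum_b_al_coef sum_al_coef sb0.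
  by rewrite !mulr0 subr0 !add0r.
move=> k l; transitivity (\sum_j n j * (y k j * x l j) - \sum_j n j * (y l j * x k j)).
  rewrite -sumrB; apply: eq_bigr => j _.
  by rewrite Im_prod_conj !ReE !ImE; ring.
by rewrite !F; ring.
Qed.

End JacobianDeterminant.

(** * Smooth maps and immersions *)

Section LocalDifferentiability.
Variables (R : numFieldType) (V W : normedModType R).

Lemma near_eq_differentiable (f g : V -> W) (x : V) :
  {near x, f =1 g} -> differentiable f x -> differentiable g x.
Proof.
move=> fg /diff_locallyP[cdf dfE].
have gE : g \o shift x = cst (g x) + 'd f x +o_ 0 id.
  apply/eqaddoP => e e0; move/eqaddoP : dfE => /(_ e e0) dfE.
  have fg0 : \forall h \near (0 : V), f (h + x) = g (h + x).
    have : \forall h \near (0 : V), (fun y => f y = g y) (h + x).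
      rewrite (near_shift x 0 (fun h => f (h + x) = g (h + x))) /=.
      by apply: filterS fg => y; rewrite /= sub0r addrNK.
    by [].
  apply: filterS2 dfE fg0 => h.
  by rewrite /= !fctE /= => dfE fgh; rewrite -fgh -(nbhs_singleton fg).
have dgf := diff_unique cdf gE.
by apply/diff_locallyP; rewrite dgf.
Qed.

End LocalDifferentiability.

Section RowVectorNorm.
Variable R : realType.

Lemma ler_norm_mxentry m n (M : 'M[R]_(m, n)) i j : `|M i j| <= `|M|.
Proof.
rewrite [leRHS]/Num.Def.normr /= mx_normrE.
exact: (le_bigmax _ (fun p => `|M p.1 p.2|) (i, j)).
Qed.

Lemma rV_norm_le n (v : 'rV[R]_n) (e : R) :
  0 <= e -> (forall i, `|v 0 i| <= e) -> `|v| <= e.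
Proof.
move=> e0 ve; rewrite [leLHS]/Num.Def.normr /= mx_normrE.
by apply: bigmax_le => // -[i j] _ /=; rewrite ord1.
Qed.

Lemma differentiable_rV k n (f : 'rV[R]_k -> 'rV[R]_n) x :
  (forall j, differentiable (fun y => f y 0 j) x) -> differentiable f x.
Proof.
move=> df.
have -> : f = \sum_(j < n) (fun y => f y 0 j *: (delta_mx 0 j : 'rV[R]_n)).
  apply/funext => y; rewrite fct_sumE.
  exact: row_sum_delta.
by apply: differentiable_sum => j; exact: differentiableZl.
Qed.

Lemma derive_rV k n (f : 'rV[R]_k -> 'rV[R]_n) x v j :
  differentiable f x -> 'D_v f x 0 j = 'D_v (fun y => f y 0 j) x.
Proof. by move=> df; rewrite derive_mx ?mxE//; exact: diff_derivable. Qed.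

End RowVectorNorm.

(** * Algebras of functions stable under differentiation *)

Section SmoothAlgebra.
Variables (R : realType) (k : nat) (V : set 'rV[R]_k).
Variable gen : set ('rV[R]_k -> R).
Hypothesis openV : open V.

Inductive gen_algebra : ('rV[R]_k -> R) -> Prop :=
| gen_algebra_gen g : gen g -> gen_algebra g
| gen_algebra_cst c : gen_algebra (cst c)
| gen_algebraD f g : gen_algebra f -> gen_algebra g -> gen_algebra (f + g)
| gen_algebraM f g : gen_algebra f -> gen_algebra g -> gen_algebra (f * g).

Lemma gen_algebraN f : gen_algebra f -> gen_algebra (- f).
Proof.
move=> gf; have -> : - f = cst (-1) * f by apply/funext => x; rewrite !fctE mulN1r.
by apply: gen_algebraM => //; exact: gen_algebra_cst.
Qed.

Hypothesis gen_diff : forall g x, gen g -> V x -> differentiable g x.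
Hypothesis gen_derive : forall g v, gen g ->
  exists2 h, gen_algebra h & forall x, V x -> 'D_v g x = h x.

Lemma gen_algebra_diff f x : gen_algebra f -> V x -> differentiable f x.
Proof.
move=> + Vx; elim=> [g gg|c|f1 f2 _ d1 _ d2|f1 f2 _ d1 _ d2].
- exact: gen_diff.
- exact: differentiable_cst.
- exact: differentiableD.
- exact: differentiableM.
Qed.

Lemma gen_algebra_derive f v : gen_algebra f ->
  exists2 h, gen_algebra h & forall x, V x -> 'D_v f x = h x.
Proof.
elim=> [g gg|c|f1 f2 g1 [h1 a1 e1] g2 [h2 a2 e2]|f1 f2 g1 [h1 a1 e1] g2 [h2 a2 e2]].
- exact: gen_derive.
- by exists (cst 0) => [|x _]; [exact: gen_algebra_cst | rewrite derive_cst].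
- exists (h1 + h2) => [|x Vx]; first exact: gen_algebraD.
  by rewrite deriveD ?e1 ?e2//; apply/diff_derivable/gen_algebra_diff.
- exists (f1 * h2 + f2 * h1) => [|x Vx].
    by apply: gen_algebraD; exact: gen_algebraM.
  by rewrite deriveM ?e1 ?e2//; apply/diff_derivable/gen_algebra_diff.
Qed.

(** Agreement is asked only on [V], because the derivatives of the generators are known only there;
    [V] being open, this is enough to differentiate again. *)
Definition entries_in_algebra n (phi : 'rV[R]_k -> 'rV[R]_n) :=
  forall j, exists2 f, gen_algebra f & forall x, V x -> phi x 0 j = f x.

Lemma entries_in_algebra_diff n (phi : 'rV[R]_k -> 'rV[R]_n) x :
  entries_in_algebra phi -> V x -> differentiable phi x.
Proof.
move=> ephi Vx; apply: differentiable_rV => j; have [f af fE] := ephi j.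
apply: (near_eq_differentiable (f := f)); last exact: gen_algebra_diff.
by apply: filterS (open_nbhs_nbhs (conj openV Vx)) => y /fE.
Qed.

Lemma entries_in_algebra_derive n (phi : 'rV[R]_k -> 'rV[R]_n) v :
  entries_in_algebra phi -> entries_in_algebra ('D_v phi).
Proof.
move=> ephi j; have [f af fE] := ephi j.
have [h ah hE] := gen_algebra_derive v af.
exists h => // x Vx; rewrite derive_rV; last exact: entries_in_algebra_diff.
rewrite -hE//; apply: near_eq_derive.
by apply: filterS (open_nbhs_nbhs (conj openV Vx)) => y /fE.
Qed.

(** Each directional derivative stays in the algebra, so induction on the list of directions reduces
    smoothness to differentiability of the elements of the algebra. *)
Lemma entries_in_algebra_smooth n (phi : 'rV[R]_k -> 'rV[R]_n) l x :
  entries_in_algebra phi -> V x -> differentiable (Defs.iterD l phi) x.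
Proof.
move=> ephi; apply: entries_in_algebra_diff.
by elim: l => //= v l; exact: entries_in_algebra_derive.
Qed.

End SmoothAlgebra.

(** * Mean value theorem and local injectivity of immersions *)

Section LocalEmbedding.
Variables (R : realType) (k n : nat).

Lemma MVT_rV (F : 'rV[R]_k -> R) (x v : 'rV[R]_k) :
  (forall s : R, 0 <= s <= 1 -> differentiable F (x + s *: v)) ->
  exists2 s : R, 0 <= s <= 1 & F (x + v) - F x = 'D_v F (x + s *: v).
Proof.
move=> dF; pose h (s : R) := F (x + s *: v).
have hE (s : R) : 0 <= s <= 1 -> is_derive s 1 h ('D_v F (x + s *: v)).
  move=> /dF/(diff_derivable (v := v)) dFs.
  have e : (fun e : R => e^-1 *: (h (e *: 1 + s) - h s)) =
      (fun e : R => e^-1 *: (F (e *: v + (x + s *: v)) - F (x + s *: v))).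
    apply/funext => e; rewrite /h; congr (_ *: (F _ - _)).
    by rewrite [e *: 1]mulr1 scalerDl addrCA.
  by apply: DeriveDef; [rewrite /derivable e | rewrite /derive e].
have [|||s] := @MVT_segment R h (fun s => 'D_v F (x + s *: v)) 0 1.
- exact: ler01.
- by move=> s /[!in_itv] /= /andP[s0 s1]; apply: hE; rewrite !ltW.
- apply: derivable_within_continuous => s; rewrite in_itv /= => /hE[] //.
rewrite in_itv /= => s01; rewrite /h scale1r scale0r addr0 subr0 mulr1 => ->.
by exists s.
Qed.

Lemma mulmx_sub_entry (v : 'rV[R]_k) (A J : 'M[R]_(k, n)) (B : 'M[R]_(n, k)) i :
  (v *m A *m B) 0 i - (v *m (J *m B)) 0 i = (v *m (A - J) *m B) 0 i.
Proof.
rewrite mulmxBr mulmxBl -(mulmxA v J B).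
by move: (v *m A *m B) (v *m (J *m B)) => X Y; rewrite !mxE.
Qed.

Lemma derive_jacobian (phi : 'rV[R]_k -> 'rV[R]_n) (x v : 'rV[R]_k) :
  differentiable phi x -> 'D_v phi x = v *m Defs.jacobian phi x.
Proof.
move=> dphi; rewrite deriveE// {1}(row_sum_delta v) linear_sum mulmx_sum_row.
by apply: eq_bigr => l _; rewrite linearZ /= rowK deriveE.
Qed.

(* Composing with a left inverse of the differential at [x0] gives a map whose
   difference with the identity is a contraction near [x0]. *)
Lemma immersion_lower_bound (phi : 'rV[R]_k -> 'rV[R]_n) (V : set 'rV[R]_k) x0 :
  open V -> V x0 -> (forall x, V x -> differentiable phi x) ->
  (forall i : 'I_k, {for x0, continuous ('D_(delta_mx 0 i) phi)}) ->
  row_free (Defs.jacobian phi x0) ->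
  exists d c : R, [/\ 0 < d, 0 < c, (forall x, `|x - x0| < d -> V x) &
    forall x y, `|x - x0| < d -> `|y - x0| < d ->
      `|y - x| <= c * `|phi y - phi x|].
Proof.
move=> oV Vx0 dphi cphi rf.
pose J := Defs.jacobian phi x0; rewrite -/J in rf; pose B := pinvmx J.
have JB : J *m B = 1%:M by rewrite mulmxVp.
(* [beta] bounds all column sums of |B|, hence the effect of [B] on the sup norm; the added 1 keeps
   it positive. *)
pose beta : R := \sum_l \sum_i `|B l i| + 1.
have beta_ge1 : 1 <= beta.
  by rewrite lerDr sumr_ge0// => l _; rewrite sumr_ge0.
have beta0 : 0 < beta by rewrite (lt_le_trans ltr01).
have Bcol i : \sum_l `|B l i| <= beta.
  rewrite ler_wpDr//; apply: ler_sum => l _.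
  by rewrite (bigD1 i)//= lerDl sumr_ge0.
have vB (v : 'rV[R]_n) i (e : R) : 0 <= e -> (forall l, `|v 0 l| <= e) ->
    `|(v *m B) 0 i| <= e * beta.
  move=> e0 ve; rewrite mxE (le_trans (ler_norm_sum _ _ _))//.
  apply: (@le_trans _ _ (\sum_l e * `|B l i|)); last by rewrite -mulr_sumr ler_wpM2l.
  by apply: ler_sum => l _; rewrite normrM ler_wpM2r.
(* Chosen so that [k.+1%:R * e * beta] is 1/2, the contraction constant; [k.+1] keeps the
   denominator nonzero when [k] is 0. *)
pose e : R := (2 * k.+1%:R * beta)^-1.
have e0 : 0 < e by rewrite invr_gt0 !mulr_gt0.
have [d1 d10 Vd1] : exists2 d : R, 0 < d & forall x, `|x - x0| < d -> V x.
  have /nbhs_ballP[d d0 dV] := open_nbhs_nbhs (conj oV Vx0).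
  exists d => // x xd; apply: dV.
  by rewrite -ball_normE /ball_ /= distrC.
have [d2 d20 Jd2] : exists2 d : R, 0 < d & forall x i, `|x - x0| < d ->
    `|'D_(delta_mx 0 i) phi x - 'D_(delta_mx 0 i) phi x0| <= e.
  have : \forall x \near x0, forall i : 'I_k,
      `|'D_(delta_mx 0 i) phi x - 'D_(delta_mx 0 i) phi x0| <= e.
    apply: (@filter_forall _ _ (fun (i : 'I_k) x =>
      `|'D_(delta_mx 0 i) phi x - 'D_(delta_mx 0 i) phi x0| <= e)
      (nbhs x0) (nbhs_filter x0)) => i.
    by move/cvgrPdistC_le : (cphi i) => /(_ e e0).
  move=> /nbhs_ballP[d d0 dV]; exists d => // x i xd; apply: dV.
  by rewrite -ball_normE /ball_ /= distrC.
exists (Num.min d1 d2), (2 * beta); split; rewrite ?mulr_gt0 ?lt_min ?d10//.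
  by move=> x; rewrite lt_min => /andP[/Vd1].
move=> x y; rewrite !lt_min => /andP[x1 x2] /andP[y1 y2].
pose v := y - x.
have seg (s d : R) : 0 <= s <= 1 -> `|x - x0| < d -> `|y - x0| < d ->
    `|x + s *: v - x0| < d.
  move=> /andP[s0 s1] xd yd.
  have -> : x + s *: v - x0 = (1 - s) *: (x - x0) + s *: (y - x0).
    by rewrite /v; apply/matrixP => a b; rewrite !mxE; ring.
  rewrite (le_lt_trans (ler_normD _ _))// !normrZ !ger0_norm ?subr_ge0//.
  have [->|s_neq0] := eqVneq s 0; first by rewrite mul0r addr0 subr0 mul1r.
  have s_gt0 : 0 < s by rewrite lt_def s_neq0.
  have -> : d = (1 - s) * d + s * d by ring.
  by rewrite ler_ltD ?ler_wpM2l ?subr_ge0 ?ltr_pM2l// ltW.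
(* The term [2^-1 * |v|] is absorbed on the left, which produces the constant [2 * beta]. *)
suff key i : `|((phi y - phi x) *m B) 0 i - v 0 i| <= 2^-1 * `|v|.
  have vle : `|v| <= `|phi y - phi x| * beta + 2^-1 * `|v|.
    apply: rV_norm_le => [|i]; first by rewrite addr_ge0 ?mulr_ge0 ?invr_ge0// ltW.
    rewrite -[v 0 i](subKr (((phi y - phi x) *m B) 0 i)).
    rewrite (le_trans (ler_normB _ _))// lerD// vB// => l.
    by exact: ler_norm_mxentry.
  by rewrite -/v; lra.
(* The mean value theorem holds only for scalar functions, so it is applied to one component of
   [phi z *m B] at a time, each with its own intermediate point. *)
pose F z := (phi z *m B) 0 i.
have dF z : V z -> differentiable F z.
  move=> /dphi dz.
  have -> : F = \sum_l (fun z => phi z 0 l * B l i).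
    by apply/funext => z'; rewrite fct_sumE /F mxE.
  apply: differentiable_sum => l; apply: differentiableM => //.
  apply: (@differentiable_comp _ _ _ _ phi (fun N => N 0 l)) => //.
  exact: differentiable_coord.
have DF z : V z -> 'D_v F z = ('D_v phi z *m B) 0 i.
  move=> /dphi dz; rewrite mxE.
  have -> : F = \sum_l (fun z => phi z 0 l * B l i).
    by apply/funext => z'; rewrite fct_sumE /F mxE.
  have dl l : derivable (fun z => phi z 0 l) z v.
    by apply: (derivable_mxP _ _ _).1; exact: diff_derivable.
  rewrite derive_sum => [|l]; last exact: derivableM.
  apply: eq_bigr => l _.
  by rewrite (deriveM (dl l))// derive_cst scaler0 add0r derive_rV// mulrC.
have [|s s01 FE] := @MVT_rV F x v.
  by move=> s s01; apply/dF/Vd1/seg.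
have xv : x + v = y by rewrite /v addrC subrK.
have Vz : V (x + s *: v) by apply/Vd1/seg.
have -> : ((phi y - phi x) *m B) 0 i = F y - F x by rewrite /F mulmxBl !mxE.
rewrite -xv FE DF//.
set z := x + s *: v in Vz *.
rewrite (derive_jacobian _ (dphi _ Vz)).
have -> : v 0 i = (v *m (J *m B)) 0 i by rewrite JB mulmx1.
rewrite mulmx_sub_entry.
have -> : 2^-1 * `|v| = (k.+1%:R * e * `|v|) * beta.
  by rewrite /e; field; rewrite gt_eqF//= pnatr_eq0.
apply: vB => [|l]; first by rewrite !mulr_ge0// ltW.
rewrite mxE (le_trans (ler_norm_sum _ _ _))//.
apply: (@le_trans _ _ (\sum_(a < k) `|v| * e)); last first.
  rewrite sumr_const card_ord -[leLHS]mulr_natl -[leRHS]mulrA (mulrC e) ler_wpM2r//.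
    by rewrite mulr_ge0// ltW.
  by rewrite ler_nat.
apply: ler_sum => a _; rewrite normrM ler_pM// ?ler_norm_mxentry//.
have := Jd2 z a (seg _ _ s01 x2 y2); apply: le_trans.
apply: le_trans (ler_norm_mxentry _ 0 l).
by rewrite !mxE.
Qed.

End LocalEmbedding.

(** * The differential equation *)

Section ComplexNorm.
Variable R : realType.
Implicit Types z y : R[i].

Definition normsq z : R := complex.Re z ^+ 2 + complex.Im z ^+ 2.

Lemma normsq_ge0 z : 0 <= normsq z.
Proof. by rewrite addr_ge0 ?sqr_ge0. Qed.

Lemma normcE_normsq z : Normc.normc z = Num.sqrt (normsq z).
Proof. by case: z. Qed.

Lemma sqr_normc_normsq z : Normc.normc z ^+ 2 = normsq z.
Proof. by rewrite normcE_normsq sqr_sqrtr// normsq_ge0. Qed.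

Lemma normsq_conj z : ((normsq z)%:C)%C = z * conjc z.
Proof. by case: z => x y; rewrite /normsq /=; simpc; congr Complex; ring. Qed.

Lemma normsqM z y : normsq (z * y) = normsq z * normsq y.
Proof. by case: z => x1 x2; case: y => y1 y2; rewrite /normsq /=; ring. Qed.

Lemma normsq_eq0 z : (normsq z == 0) = (z == 0).
Proof. by rewrite paddr_eq0 ?sqr_ge0// !sqrf_eq0 eq_complex. Qed.

Lemma normsq_neq0_gt0 z : z != 0 -> 0 < normsq z.
Proof. by move=> z0; rewrite lt_def normsq_eq0 z0 normsq_ge0. Qed.

Lemma normc_ge0 z : 0 <= Normc.normc z.
Proof. by rewrite normcE_normsq sqrtr_ge0. Qed.

Lemma normc_conj z : Normc.normc (conjc z) = Normc.normc z.
Proof. by case: z => x y /=; rewrite sqrrN. Qed.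

Lemma ler_normc_add z y :
  Normc.normc (z + y) <= Normc.normc z + Normc.normc y.
Proof. by rewrite -lecR rmorphD /=; exact: (@ler_normD _ R[i]). Qed.

Lemma ler_abs_Re_conj z y :
  `|complex.Re (z * conjc y)| <= Normc.normc z * Normc.normc y.
Proof.
rewrite -(normc_conj y) -Normc.normcM; case: (z * conjc y) => p q /=.
by rewrite -sqrtr_sqr ler_wsqrtr// lerDl sqr_ge0.
Qed.

End ComplexNorm.

(** * Lipschitz bounds for products on bounded sets *)

Section ProductLipschitz.
Variables (R : realType) (m : nat) (M : R).
Hypothesis M1 : 1 <= M.
Local Notation normc := Normc.normc.

Lemma normc_prod_le (r : seq 'I_m) (P : pred 'I_m) (z : 'I_m -> R[i]) :
  (forall i, normc (z i) <= M) ->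
  normc (\prod_(i <- r | P i) z i) <= M ^+ size r.
Proof.
move=> zM; have M0 : 0 <= M by rewrite (le_trans ler01).
elim: r => [|i r IH]; first by rewrite big_nil Normc.normc1.
rewrite big_cons /= exprS; case: ifP => _.
  by rewrite Normc.normcM ler_pM ?normc_ge0.
by rewrite (le_trans IH)// ler_peMl// exprn_ge0.
Qed.

(** Induction on [r], changing one factor at a time; on the remaining factors [normc_prod_le] gives
    the bound [M ^+ size r]. *)
Lemma prod_lipschitz (r : seq 'I_m) (P : pred 'I_m) :
  exists2 L : R, 0 <= L & forall z y : 'I_m -> R[i],
    (forall i, normc (z i) <= M) -> (forall i, normc (y i) <= M) ->
    normc (\prod_(i <- r | P i) z i - \prod_(i <- r | P i) y i)
    <= L * \sum_i normc (z i - y i).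
Proof.
have M0 : 0 <= M by rewrite (le_trans ler01).
elim: r => [|i r [L L0 IH]].
  by exists 0 => // z y _ _; rewrite !big_nil subrr Normc.normc0 mul0r.
exists (M ^+ size r + (M + 1) * L).
  by rewrite addr_ge0 ?exprn_ge0 ?mulr_ge0 ?addr_ge0.
move=> z y zM yM; rewrite !big_cons; set S := \sum_i _.
have S0 : 0 <= S by rewrite sumr_ge0 => // j _; rewrite normc_ge0.
have H := IH z y zM yM; rewrite -/S in H.
have Lle : L * S <= (M ^+ size r + (M + 1) * L) * S.
  rewrite ler_wpM2r// -[leLHS]add0r lerD ?exprn_ge0//.
  by rewrite ler_peMl// lerDr.
case: ifP => _; last exact: le_trans H Lle.
set X := \prod_(j <- r | P j) z j in H *; set Y := \prod_(j <- r | P j) y j in H *.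
have -> : z i * X - y i * Y = (z i - y i) * X + y i * (X - Y) by ring.
rewrite (le_trans (ler_normc_add _ _))// !Normc.normcM mulrDl lerD//.
  rewrite mulrC ler_pM ?normc_ge0 ?normc_prod_le//.
  by rewrite /S (bigD1 i)//= lerDl sumr_ge0// => j _; rewrite normc_ge0.
apply: (@le_trans _ _ (M * (L * S))); first by rewrite ler_pM ?normc_ge0.
by rewrite -mulrA ler_wpM2r ?mulr_ge0// lerDl.
Qed.

End ProductLipschitz.

(** * Constancy and the Gronwall inequality *)

Section ScalarODE.
Variables (R : realType) (lo hi : R).

Lemma derive0_constant (g : R -> R) :
  (forall t, lo < t < hi -> is_derive t 1 g 0) ->
  forall s t, lo < s < hi -> lo < t < hi -> g s = g t.
Proof.
move=> dg; suff H s t : lo < s < hi -> lo < t < hi -> s <= t -> g s = g t.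
  by move=> s t si ti; case: (leP s t) => [|/ltW] st; [|symmetry]; exact: H.
move=> /andP[s1 s2] /andP[t1 t2] st.
have inI x : x \in `[s, t] -> lo < x < hi.
  rewrite in_itv /= => /andP[sx xt].
  by rewrite (lt_le_trans s1)//= (le_lt_trans xt).
have [||c _] := @MVT_segment R g (fun=> 0) s t st.
- by move=> x xi; apply/dg/inI; exact: subset_itv_oo_cc.
- by apply: derivable_within_continuous => x /inI/dg[].
by rewrite mul0r => /eqP; rewrite subr_eq0 => /eqP ->.
Qed.

(** [E] times [expR (- C * t)] is nonincreasing and [E] times [expR (C * t)] is nondecreasing; the
    first settles [t <= s], the second [s < t]. *)
Lemma gronwall_two_sided (E dE : R -> R) (C : R) :
  (forall t, lo < t < hi -> is_derive t 1 E (dE t)) ->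
  (forall t, lo < t < hi -> `|dE t| <= C * E t) ->
  forall s t, lo < s < hi -> lo < t < hi -> E s <= expR (C * `|s - t|) * E t.
Proof.
move=> hE hdE.
have inI (s t x : R) : lo < s < hi -> lo < t < hi -> x \in `[s, t] -> lo < x < hi.
  move=> /andP[s1 s2] /andP[t1 t2]; rewrite in_itv /= => /andP[sx xt].
  by rewrite (lt_le_trans s1)//= (le_lt_trans xt).
have dF (c t : R) : lo < t < hi ->
    is_derive t 1 (fun x => E x * expR (c * x)) (expR (c * t) * (dE t + c * E t)).
  move=> ti; have hEt := hE t ti.
  have hx : is_derive t 1 (fun x => expR (c * x)) (expR (c * t) * c).
    apply: (@is_derive1_comp _ expR ( *%R c)).
    have -> : *%R c = c *: (id : R -> R) by apply/funext.
    by apply: is_derive_eq; rewrite [_ *: _]mulr1.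
  apply: (is_derive_eq (is_deriveM hEt hx)).
  by rewrite /GRing.scale /=; ring.
move=> s t si ti; case: (leP t s) => [ts|/ltW st].
  rewrite ger0_norm ?subr_ge0//.
  have : E s * expR (- C * s) <= E t * expR (- C * t).
    apply: (@ler0_derive1_nincr R (fun x => E x * expR (- C * x)) t s) => //.
    - by move=> x xi; case: (dF (- C) x (inI t s x ti si (subset_itv_oo_cc xi))).
    - move=> x xi; have xI := inI t s x ti si (subset_itv_oo_cc xi).
      have dFx := dF (- C) x xI; rewrite derive1E (derive_val).
      rewrite mulr_ge0_le0 ?expR_ge0// mulNr subr_le0.
      by rewrite (le_trans _ (hdE x xI))// ler_norm.
    - apply: derivable_within_continuous => x xi.
      by case: (dF (- C) x (inI t s x ti si xi)).
  rewrite mulrBr expRD -mulrN !mulNr !expRN => H.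
  rewrite -mulrA mulrC -ler_pdivrMr ?expR_gt0// mulrC.
  by rewrite mulrC (le_trans H)// mulrN expRN mulrC.
rewrite ler0_norm ?subr_le0// opprB.
have : E s * expR (C * s) <= E t * expR (C * t).
  apply: (@ger0_derive1_ndecr R (fun x => E x * expR (C * x)) s t) => //.
  - by move=> x xi; case: (dF C x (inI s t x si ti (subset_itv_oo_cc xi))).
  - move=> x xi; have xI := inI s t x si ti (subset_itv_oo_cc xi).
    have dFx := dF C x xI; rewrite derive1E (derive_val).
    rewrite mulr_ge0 ?expR_ge0//.
    by have := hdE x xI; rewrite ler_norml => /andP[+ _]; rewrite -subr_ge0 opprK.
  - apply: derivable_within_continuous => x xi.
    by case: (dF C x (inI s t x si ti xi)).
rewrite mulrBr expRD expRN => H.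
by rewrite mulrAC ler_pdivlMr ?expR_gt0// [leRHS]mulrC.
Qed.

End ScalarODE.

(** * Stability of the solutions of (A) *)

Section ComplexODE.
Variables (R : realType) (m : nat) (b : 'I_m -> R).
Local Notation normc := Normc.normc.

Definition is_cderive (f : R -> R[i]) (t : R) (df : R[i]) : Prop :=
  is_derive t 1 (reF f) (complex.Re df) /\ is_derive t 1 (imF f) (complex.Im df).

Definition vfield (z : 'I_m -> R[i]) (j : 'I_m) : R[i] :=
  ((b j)%:C)%C * conjc (\prod_(k < m | k != j) z k).

Definition solution_on (lo hi : R) (z : 'I_m -> R -> R[i]) :=
  forall j t, lo < t < hi -> is_cderive (z j) t (vfield (z^~ t) j).

Definition sqdist (z y : 'I_m -> R[i]) : R := \sum_j normsq (z j - y j).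

Lemma sqdist_ge0 z y : 0 <= sqdist z y.
Proof. by rewrite sumr_ge0 // => j _; exact: normsq_ge0. Qed.

Lemma sqdist_eq0 z y : sqdist z y = 0 -> forall j, z j = y j.
Proof.
move=> /eqP; rewrite psumr_eq0 => [|j _]; last exact: normsq_ge0.
move=> /allP H j; have := H j (mem_index_enum j); rewrite normsq_eq0.
by rewrite subr_eq0 => /eqP.
Qed.

Lemma vfield_lipschitz (M : R) : 1 <= M ->
  exists2 L : R, 0 <= L & forall z y : 'I_m -> R[i],
    (forall i, normc (z i) <= M) -> (forall i, normc (y i) <= M) ->
    forall j, normc (vfield z j - vfield y j) <= L * \sum_i normc (z i - y i).
Proof.
move=> M1.
have HL j : exists L : R, 0 <= L /\ forall z y : 'I_m -> R[i],
    (forall i, normc (z i) <= M) -> (forall i, normc (y i) <= M) ->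
    normc (\prod_(k < m | k != j) z k - \prod_(k < m | k != j) y k)
      <= L * \sum_i normc (z i - y i).
  by have [L L0 H] := prod_lipschitz M1 (index_enum 'I_m) (fun k => k != j); exists L.
have {HL}[L HL] := choice HL.
exists (\sum_j `|b j| * L j).
  by rewrite sumr_ge0// => j _; rewrite mulr_ge0//; case: (HL j).
move=> z y zM yM j; rewrite /vfield -mulrBr -rmorphB Normc.normcM normc_conj.
set S := \sum_i normc _.
have S0 : 0 <= S by rewrite sumr_ge0 => // i _; rewrite normc_ge0.
have -> : normc ((b j)%:C)%C = `|b j| by rewrite /= expr0n addr0 sqrtr_sqr.
apply: (@le_trans _ _ (`|b j| * L j * S)).
  by rewrite -mulrA ler_wpM2l//; case: (HL j) => _; exact.
rewrite ler_wpM2r// (bigD1 j)//= lerDl sumr_ge0// => i _.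
by rewrite mulr_ge0//; case: (HL i).
Qed.

(** Gronwall for the squared distance of two solutions. Bounding every [normc (d j t)] by the root
    of [E], both inside the Lipschitz estimate and in the sum over [j], gives the factor
    [m%:R ^+ 2]. [C] depends on [M] but not on the interval or the solutions. *)
Lemma solution_stability (M : R) : 1 <= M -> exists C : R,
  forall (lo hi : R) (z y : 'I_m -> R -> R[i]),
  solution_on lo hi z -> solution_on lo hi y ->
  (forall j t, lo < t < hi -> normc (z j t) <= M) ->
  (forall j t, lo < t < hi -> normc (y j t) <= M) ->
  forall s t, lo < s < hi -> lo < t < hi ->
    sqdist (z^~ s) (y^~ s) <= expR (C * `|s - t|) * sqdist (z^~ t) (y^~ t).
Proof.
move=> M1; have [L L0 HL] := vfield_lipschitz M1.
exists (2 * L * m%:R ^+ 2) => lo hi z y sz sy zM yM.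
pose d j t := z j t - y j t; pose d' j t := vfield (z^~ t) j - vfield (y^~ t) j.
apply: (@gronwall_two_sided R lo hi (fun t => sqdist (z^~ t) (y^~ t))
  (fun t => \sum_j 2 * complex.Re (d' j t * conjc (d j t)))) => [t ti|t ti].
  have -> : (fun t => sqdist (z^~ t) (y^~ t)) =
      \sum_j ((reF (z j) - reF (y j)) ^+ 2 + (imF (z j) - imF (y j)) ^+ 2).
    apply/funext => x; rewrite /sqdist fct_sumE; apply: eq_bigr => j _.
    rewrite /normsq !fctE /reF /imF.
    by case: (z j x) => ? ?; case: (y j x).
  have dj (j : 'I_m) : is_derive t 1
      ((reF (z j) - reF (y j)) ^+ 2 + (imF (z j) - imF (y j)) ^+ 2)
      (2 * complex.Re (d' j t * conjc (d j t))).
    have [hz1 hz2] := sz j t ti; have [hy1 hy2] := sy j t ti.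
    have h1 := is_deriveX 2 (is_deriveB hz1 hy1).
    have h2 := is_deriveX 2 (is_deriveB hz2 hy2).
    apply: (is_derive_eq (is_deriveD h1 h2)).
    rewrite Re_prod_conj /d /d' /reF /imF !fctE /GRing.scale /=.
    case: (z j t) => z1 z2; case: (y j t) => y1 y2 /=.
    case: (vfield (z^~ t) j) => a1 a2; case: (vfield (y^~ t) j) => b1 b2 /=.
    by ring.
  exact: (is_derive_sum dj).
set E := sqdist _ _.
have dE j : normc (d j t) <= Num.sqrt E.
  rewrite normcE_normsq ler_wsqrtr// /E /sqdist (bigD1 j)//= lerDl sumr_ge0// => i _.
  exact: normsq_ge0.
have SE : \sum_j normc (d j t) <= m%:R * Num.sqrt E.
  rewrite (le_trans (ler_sum _ (fun j _ => dE j)))//.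
  by rewrite sumr_const card_ord -[leLHS]mulr_natl.
have sE : Num.sqrt E * Num.sqrt E = E by rewrite -expr2 sqr_sqrtr// sqdist_ge0.
rewrite (le_trans (ler_norm_sum _ _ _))//.
apply: (@le_trans _ _ (\sum_(j < m) (2 * (L * (m%:R * Num.sqrt E))) * Num.sqrt E)).
  apply: ler_sum => j _; rewrite normrM ger0_norm// -mulrA ler_pM2l//.
  rewrite (le_trans (ler_abs_Re_conj _ _))// ler_pM ?normc_ge0//.
  rewrite (le_trans (HL _ _ _ _ j)) ?ler_wpM2l// => i; [exact: zM|exact: yM].
rewrite sumr_const card_ord -[leLHS]mulr_natl -[in leRHS]sE.
by rewrite le_eqVlt; apply/orP; left; apply/eqP; ring.
Qed.

End ComplexODE.

(** * The parametrisation of N *)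

Section LinearForms.
Variables (R : realType) (m : nat).
Implicit Types (c : 'I_m -> R) (x y v : 'rV[R]_m).

Definition linform c x : R := \sum_k c k * x 0 k.

Lemma linformD c x y : linform c (x + y) = linform c x + linform c y.
Proof. by rewrite -big_split; apply: eq_bigr => k _; rewrite mxE mulrDr. Qed.

Lemma linformN c x : linform c (- x) = - linform c x.
Proof. by rewrite -sumrN; apply: eq_bigr => k _; rewrite mxE mulrN. Qed.

Lemma linform_delta c k : linform c (delta_mx 0 k) = c k.
Proof.
rewrite /linform (bigD1 k)//= mxE !eqxx mulr1 big1 ?addr0// => j /negbTE jk.
by rewrite mxE eqxx jk mulr0.
Qed.

Lemma differentiable_linform c x : differentiable (linform c) x.
Proof.
have -> : linform c = \sum_k (c k *: (fun y : 'rV[R]_m => y 0 k : R)).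
  by apply/funext => y; rewrite fct_sumE.
apply: differentiable_sum => k; apply: differentiableZ.
exact: differentiable_coord.
Qed.

Lemma linform_continuous c : continuous (linform c).
Proof. by move=> x; apply: differentiable_continuous; exact: differentiable_linform. Qed.

Lemma derive_linform c x v : 'D_v (linform c) x = linform c v.
Proof.
have -> : linform c = \sum_k (c k *: (fun y : 'rV[R]_m => y 0 k : R)).
  by apply/funext => y; rewrite fct_sumE.
have dc k : derivable (fun y : 'rV[R]_m => y 0 k : R) x v.
  by apply: diff_derivable; exact: differentiable_coord.
rewrite derive_sum => [|k]; last exact: derivableZ.
rewrite fct_sumE; apply: eq_bigr => k _; rewrite deriveZ//; congr (_ *: _).
rewrite -(@derive_rV R m m id x v k); last exact: ex_diff.
by rewrite derive_id.
Qed.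

Lemma is_derive_linform c x v : is_derive x v (linform c) (linform c v).
Proof.
apply: DeriveDef; last exact: derive_linform.
by apply: diff_derivable; exact: differentiable_linform.
Qed.

Lemma differentiable_comp_linform (f : R -> R) c x :
  derivable f (linform c x) 1 -> differentiable (f \o linform c) x.
Proof.
move=> /derivable1_diffP df; apply: differentiable_comp => //.
exact: differentiable_linform.
Qed.

Lemma is_derive_comp_linform (f : R -> R) df c x v :
  is_derive (linform c x) 1 f df ->
  is_derive x v (f \o linform c) (linform c v * df).
Proof.
move=> [dfx <-]; have dfx' := dfx; move/derivable1_diffP in dfx'.
have dl := differentiable_linform c x.
apply: DeriveDef; first exact/diff_derivable/differentiable_comp.
rewrite deriveE; last exact: differentiable_comp.
by rewrite diff_comp//= deriv1E//= derive1E -(deriveE v dl) derive_linform.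
Qed.

End LinearForms.

Section ComplexExponential.
Variable R : realType.
Implicit Types x y : R.

Lemma expi0 : expi (0 : R) = 1.
Proof. by rewrite /expi cos0 sin0. Qed.

Lemma expiD x y : expi (x + y) = expi x * expi y.
Proof. by rewrite /expi cosD sinD; congr Complex; rewrite addrC [sin x * _]mulrC. Qed.

Lemma expi_sum (I : Type) (r : seq I) (P : pred I) (F : I -> R) :
  expi (\sum_(i <- r | P i) F i) = \prod_(i <- r | P i) expi (F i).
Proof. by apply: (big_morph (@expi R)); [exact: expiD | exact: expi0]. Qed.

Lemma normsq_expi x : normsq (expi x) = 1.
Proof. by rewrite /normsq /= cos2Dsin2. Qed.

Lemma conj_expi x : conjc (expi x) = expi (- x).
Proof. by rewrite /expi cosN sinN. Qed.

End ComplexExponential.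

Section Realify.
Variables (R : realType) (m : nat).

Lemma realify_lshift (z : 'I_m -> R[i]) j : realify z 0 (lshift m j) = complex.Re (z j).
Proof. by rewrite mxE -[lshift m j]/(unsplit (inl j)) unsplitK. Qed.

Lemma realify_rshift (z : 'I_m -> R[i]) j : realify z 0 (rshift m j) = complex.Im (z j).
Proof. by rewrite mxE -[rshift m j]/(unsplit (inr j)) unsplitK. Qed.

End Realify.

(** * The map [phi], its smoothness and its Jacobian *)

Section Chart.
Variables (R : realType) (m : nat) (b : 'I_m -> R) (eps : R).
Variables (w : 'I_m -> R -> R[i]) (u : R -> R).
Hypothesis m_ge3 : (3 <= m)%N.
Hypothesis sum_b : \sum_j b j = 0.
Let s := \sum_j b j ^+ 2.
Hypothesis s_neq0 : s != 0.
Hypothesis w_neq0 : forall j t, - eps < t < eps -> w j t != 0.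
Hypothesis w_sol : solution_on b (- eps) eps w.
Hypothesis w_norm : forall j t, - eps < t < eps -> normsq (w j t) = b j * u t + 1.

Let mR_neq0 : m%:R != 0 :> R.
Proof. by rewrite pnatr_eq0 -lt0n (leq_trans _ m_ge3). Qed.

(** [rho] and [tau] are the coefficients along (1,...,1) and [b] in the orthogonal decomposition of
    R^m, and [al] is the component in W. *)
Definition rho : 'rV[R]_m -> R := linform (fun=> m%:R^-1).
Definition tau : 'rV[R]_m -> R := linform (fun k => b k / s).
Definition al (j : 'I_m) : 'rV[R]_m -> R := linform (al_coef b ^~ j).
Definition chart_point (r t : R) (th : 'I_m -> R) : 'rV[R]_m :=
  \row_j (r + t * b j + th j).

Lemma alE j x : al j x = x 0 j - rho x - b j * tau x.
Proof.
have -> : x 0 j = \sum_k (j == k)%:R * x 0 k.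
  rewrite (bigD1 j)//= eqxx mul1r big1 ?addr0// => k.
  by rewrite eq_sym => /negbTE ->; rewrite mul0r.
rewrite /al /rho /tau /linform mulr_sumr -!sumrB.
by apply: eq_bigr => k _; rewrite /al_coef -/s; ring.
Qed.

Lemma sum_al x : \sum_j al j x = 0.
Proof.
rewrite /al /linform exchange_big /= big1// => k _.
by rewrite -mulr_suml sum_al_coef ?mul0r.
Qed.

Lemma sum_b_al x : \sum_j b j * al j x = 0.
Proof.
under eq_bigr do rewrite /al /linform mulr_sumr.
rewrite exchange_big /= big1// => k _.
by under eq_bigr do rewrite mulrA; rewrite -mulr_suml sum_b_al_coef ?mul0r.
Qed.

Section PointCoordinates.
Variables (r t : R) (th : 'I_m -> R).
Hypothesis sum_th : \sum_j th j = 0.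
Hypothesis sum_b_th : \sum_j b j * th j = 0.

Lemma rho_point : rho (chart_point r t th) = r.
Proof.
rewrite /rho /linform -mulr_sumr; under eq_bigr do rewrite mxE.
rewrite !big_split /= sum_th -mulr_sumr sum_b mulr0 !addr0 sumr_const card_ord.
by rewrite -[r *+ m]mulr_natl mulrA mulVf// mul1r.
Qed.

Lemma tau_point : tau (chart_point r t th) = t.
Proof.
rewrite /tau /linform.
transitivity ((\sum_j b j * r + \sum_j b j ^+ 2 * t + \sum_j b j * th j) / s).
  rewrite -!big_split /= mulr_suml; apply: eq_bigr => j _.
  by rewrite mxE; ring.
by rewrite sum_b_th -!mulr_suml sum_b mul0r add0r addr0 -/s mulrAC divff// mul1r.
Qed.

Lemma al_point j : al j (chart_point r t th) = th j.
Proof. by rewrite alE rho_point tau_point mxE; ring. Qed.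

End PointCoordinates.

Definition cphi (x : 'rV[R]_m) (j : 'I_m) : R[i] :=
  ((rho x)%:C)%C * expi (al j x) * w j (tau x).
Definition phi (x : 'rV[R]_m) : 'rV[R]_(m + m) := realify (cphi x).
Definition dom : set 'rV[R]_m := [set x | 0 < rho x /\ - eps < tau x < eps].

Lemma open_dom : open dom.
Proof.
have -> : dom = rho @^-1` [set r | 0 < r] `&` tau @^-1` [set t | - eps < t]
    `&` tau @^-1` [set t | t < eps].
  apply/seteqP; split=> x /=; [by move=> [? /andP[]] | move=> [[? h1] h2]].
  by split=> //; apply/andP.
apply: openI; first apply: openI.
- by apply: open_comp => [x _|]; [exact: linform_continuous | exact: open_gt].
- by apply: open_comp => [x _|]; [exact: linform_continuous | exact: open_gt].
- by apply: open_comp => [x _|]; [exact: linform_continuous | exact: open_lt].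
Qed.

Inductive chart_gen : ('rV[R]_m -> R) -> Prop :=
| chart_gen_rho : chart_gen rho
| chart_gen_cos j : chart_gen (cos \o al j)
| chart_gen_sin j : chart_gen (sin \o al j)
| chart_gen_re j : chart_gen (reF (w j) \o tau)
| chart_gen_im j : chart_gen (imF (w j) \o tau).

Local Notation chart_alg := (gen_algebra chart_gen).

Lemma chart_gen_diff g x : chart_gen g -> dom x -> differentiable g x.
Proof.
move=> gg [_ tx]; case: gg => [|j|j|j|j].
- exact: differentiable_linform.
- by apply: differentiable_comp_linform.
- by apply: differentiable_comp_linform.
- by apply: differentiable_comp_linform; case: (w_sol j tx) => -[].
- by apply: differentiable_comp_linform; case: (w_sol j tx) => _ [].
Qed.

(** Needed for the right-hand side of (A), which is a conjugated product of the [w k]. *)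
Lemma chart_alg_prod (r : seq 'I_m) (P : pred 'I_m) :
  chart_alg (fun x => complex.Re (\prod_(k <- r | P k) w k (tau x))) /\
  chart_alg (fun x => complex.Im (\prod_(k <- r | P k) w k (tau x))).
Proof.
elim: r => [|k r [IHre IHim]].
  split.
    by under eq_fun do rewrite big_nil; exact: gen_algebra_cst.
  by under eq_fun do rewrite big_nil; exact: gen_algebra_cst.
have hre := gen_algebra_gen (chart_gen_re k).
have him := gen_algebra_gen (chart_gen_im k).
case Pk : (P k); last first.
  by split; under eq_fun do rewrite big_cons Pk.
split.
  have -> : (fun x => complex.Re (\prod_(k <- k :: r | P k) w k (tau x))) =
     (reF (w k) \o tau) * (fun x => complex.Re (\prod_(k <- r | P k) w k (tau x)))
     - (imF (w k) \o tau) * (fun x => complex.Im (\prod_(k <- r | P k) w k (tau x))).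
    apply/funext => x; rewrite big_cons Pk !fctE /reF /imF /=.
    by case: (w k (tau x)) => ? ?; case: (\prod_(_ <- r | _) _).
  by apply: gen_algebraD; [|apply: gen_algebraN]; exact: gen_algebraM.
have -> : (fun x => complex.Im (\prod_(k <- k :: r | P k) w k (tau x))) =
     (reF (w k) \o tau) * (fun x => complex.Im (\prod_(k <- r | P k) w k (tau x)))
     + (imF (w k) \o tau) * (fun x => complex.Re (\prod_(k <- r | P k) w k (tau x))).
  apply/funext => x; rewrite big_cons Pk !fctE /reF /imF /=.
  by case: (w k (tau x)) => ? ?; case: (\prod_(_ <- r | _) _).
by apply: gen_algebraD; exact: gen_algebraM.
Qed.

Lemma chart_gen_derive g v : chart_gen g ->
  exists2 h, chart_alg h & forall x, dom x -> 'D_v g x = h x.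
Proof.
case=> [|j|j|j|j].
- exists (cst (rho v)); first exact: gen_algebra_cst.
  by move=> x _; rewrite /rho derive_linform.
- exists (cst (al j v) * - (sin \o al j)).
    apply: gen_algebraM; first exact: gen_algebra_cst.
    by apply/gen_algebraN/gen_algebra_gen/chart_gen_sin.
  move=> x _; have H := is_derive_comp_linform v (is_derive_cos (al j x)).
  by rewrite (@derive_val _ _ _ _ _ _ _ H).
- exists (cst (al j v) * (cos \o al j)).
    apply: gen_algebraM; first exact: gen_algebra_cst.
    by apply/gen_algebra_gen/chart_gen_cos.
  move=> x _; have H := is_derive_comp_linform v (is_derive_sin (al j x)).
  by rewrite (@derive_val _ _ _ _ _ _ _ H).
- exists (cst (tau v) * (cst (b j) *
      (fun x => complex.Re (\prod_(k < m | k != j) w k (tau x))))).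
    do 2![apply: gen_algebraM; first exact: gen_algebra_cst].
    by case: (chart_alg_prod (index_enum 'I_m) (fun k => k != j)).
  move=> x [_ tx]; have [H _] := w_sol j tx.
  rewrite (@derive_val _ _ _ _ _ _ _ (is_derive_comp_linform v H)) /vfield.
  set z := \prod_(k < m | k != j) w k (tau x).
  rewrite -/(tau v) -[RHS]/(tau v * (b j * complex.Re z)).
  by case: z => p q /=; ring.
- exists (cst (tau v) * (cst (- b j) *
      (fun x => complex.Im (\prod_(k < m | k != j) w k (tau x))))).
    do 2![apply: gen_algebraM; first exact: gen_algebra_cst].
    by case: (chart_alg_prod (index_enum 'I_m) (fun k => k != j)).
  move=> x [_ tx]; have [_ H] := w_sol j tx.
  rewrite (@derive_val _ _ _ _ _ _ _ (is_derive_comp_linform v H)) /vfield.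
  set z := \prod_(k < m | k != j) w k (tau x).
  rewrite -/(tau v) -[RHS]/(tau v * ((- b j) * complex.Im z)).
  by case: z => p q /=; ring.
Qed.

Lemma Re_cphi j : (fun x => complex.Re (cphi x j)) =
  rho * ((cos \o al j) * (reF (w j) \o tau) - (sin \o al j) * (imF (w j) \o tau)).
Proof.
apply/funext => x; rewrite /cphi !fctE /reF /imF /=.
by case: (w j (tau x)) => p q /=; ring.
Qed.

Lemma Im_cphi j : (fun x => complex.Im (cphi x j)) =
  rho * ((cos \o al j) * (imF (w j) \o tau) + (sin \o al j) * (reF (w j) \o tau)).
Proof.
apply/funext => x; rewrite /cphi !fctE /reF /imF /=.
by case: (w j (tau x)) => p q /=; ring.
Qed.

Lemma phi_entries_in_algebra : entries_in_algebra dom chart_gen phi.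
Proof.
have ac j := gen_algebra_gen (chart_gen_cos j).
have as_ j := gen_algebra_gen (chart_gen_sin j).
have ar j := gen_algebra_gen (chart_gen_re j).
have ai j := gen_algebra_gen (chart_gen_im j).
move=> i; rewrite -(splitK i); case: (fintype.split i) => j /=.
  exists (fun x => complex.Re (cphi x j)) => [|x _]; last by rewrite realify_lshift.
  rewrite Re_cphi; apply: gen_algebraM; first exact: gen_algebra_gen chart_gen_rho.
  by apply: gen_algebraD; [|apply: gen_algebraN]; exact: gen_algebraM.
exists (fun x => complex.Im (cphi x j)) => [|x _]; last by rewrite realify_rshift.
rewrite Im_cphi; apply: gen_algebraM; first exact: gen_algebra_gen chart_gen_rho.
by apply: gen_algebraD; exact: gen_algebraM.
Qed.

Lemma phi_smooth l x : dom x -> differentiable (Defs.iterD l phi) x.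
Proof.
move=> dx; apply: (entries_in_algebra_smooth open_dom chart_gen_diff
  chart_gen_derive _ phi_entries_in_algebra dx).
Qed.

Lemma phi_diff x : dom x -> differentiable phi x.
Proof. exact: (phi_smooth [::]). Qed.

Lemma phi_derive_continuous v x : dom x -> {for x, continuous ('D_v phi)}.
Proof.
move=> dx; apply: differentiable_continuous.
exact: (phi_smooth [:: v]).
Qed.

Let q t := \prod_(j < m) w j t.

(** Inserting [w j t * conjc (w j t) / normsq (w j t)], which is 1, completes the product with
    omitted factor to [q t]; (A) becomes a formula for the logarithmic derivative of [w j]. *)
Lemma vfield_w j t : - eps < t < eps ->
  vfield b (w^~ t) j = ((b j * (normsq (w j t))^-1)%:C)%C * conjc (q t) * w j t.
Proof.
move=> ti; have wj0 := w_neq0 j ti.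
have n0 : normsq (w j t) != 0 by rewrite normsq_eq0.
rewrite /vfield /q [in RHS](bigD1 j)//= rmorphM [in RHS]rmorphM -!mulrA; congr (_ * _).
set X := conjc _.
transitivity ((((normsq (w j t))^-1)%:C)%C * (w j t * conjc (w j t)) * X).
  by rewrite -normsq_conj -rmorphM mulVf// rmorph1 mul1r.
by ring.
Qed.

(** By the product rule [jac_coef] adds the logarithmic derivatives of the three factors of
    [cphi x j]: the radius gives the real part 1/(rm), the rotation the imaginary part [al_coef],
    and [w j] the term with [conjc q]. *)
Lemma dz_jacobian_phi x k j : dom x ->
  dz j (row k (Defs.jacobian phi x)) =
  cphi x j * jac_coef b (rho x) (q (tau x)) (fun i => (normsq (w i (tau x)))^-1) k j.
Proof.
move=> dx; have [rho0 tx] := dx; have dphi := phi_diff dx.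
set v : 'rV[R]_m := delta_mx 0 k.
have rv : rho v = m%:R^-1 by rewrite /rho linform_delta.
have tv : tau v = b k / s by rewrite /tau linform_delta.
have av : al j v = al_coef b k j by rewrite /al linform_delta.
have D1 := is_derive_linform (fun=> m%:R^-1) x v; rewrite -/rho -/(rho v) rv in D1.
have Dc := is_derive_comp_linform v (is_derive_cos (al j x)).
have Ds := is_derive_comp_linform v (is_derive_sin (al j x)).
rewrite -/(al j) -/(al j v) av in Dc Ds.
have [Wr Wi] := w_sol j tx.
have Dr := is_derive_comp_linform v Wr; have Di := is_derive_comp_linform v Wi.
rewrite -/tau -/(tau v) tv in Dr Di.
have DRe := is_deriveM D1 (is_deriveB (is_deriveM Dc Dr) (is_deriveM Ds Di)).
have DIm := is_deriveM D1 (is_deriveD (is_deriveM Dc Di) (is_deriveM Ds Dr)).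
rewrite /dz !mxE !derive_rV//.
have -> : (fun y => phi y 0 (lshift m j)) = (fun y => complex.Re (cphi y j)).
  by apply/funext => y; rewrite realify_lshift.
have -> : (fun y => phi y 0 (rshift m j)) = (fun y => complex.Im (cphi y j)).
  by apply/funext => y; rewrite realify_rshift.
rewrite Re_cphi Im_cphi (@derive_val _ _ _ _ _ _ _ DRe) (@derive_val _ _ _ _ _ _ _ DIm).
rewrite vfield_w// /cphi /jac_coef -/s !fctE /reF /imF /=.
case: (w j (tau x)) => w1 w2; case: (q (tau x)) => q1 q2 /=.
set n := (normsq _)^-1; set A := al_coef b k j.
have rr : rho x != 0 by rewrite gt_eqF.
rewrite /GRing.scale /=.
apply/eqP; rewrite eq_complex /=; apply/andP.
by split; apply/eqP; field; rewrite ?mR_neq0 ?rr ?s_neq0.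
Qed.

Lemma normsq_cphi x j : dom x -> normsq (cphi x j) = rho x ^+ 2 * (b j * u (tau x) + 1).
Proof.
move=> [_ tx]; rewrite /cphi !normsqM normsq_expi mulr1 w_norm//.
by rewrite /normsq /= expr0n addr0.
Qed.

Lemma prod_cphi x : \prod_j cphi x j = ((rho x ^+ m)%:C)%C * q (tau x).
Proof.
rewrite /cphi !big_split /= -expi_sum sum_al expi0 mulr1 prodr_const card_ord.
by rewrite -rmorphXn.
Qed.

(** The Jacobian is the matrix [jac_coef] with column [j] multiplied by [cphi x j]. For isotropy
    this supplies the weights [normsq (w j)] up to [rho x ^+ 2]; for the determinant it supplies
    [q], which turns [conjc q] into the positive number [normsq q] and leaves a positive multiple of
    [c]. *)
Lemma phi_calibrated x : dom x ->
  let c := (Complex 0 1 : R[i]) ^+ (m - 2) in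
  row_free (Defs.jacobian phi x) /\
  complex.Re c * complex.Re (Omega (Defs.jacobian phi x))
    + complex.Im c * complex.Im (Omega (Defs.jacobian phi x))
  = induced_vol (Defs.jacobian phi x).
Proof.
move=> dx c; have [rho0 tx] := dx.
have n_gt0 j : 0 < normsq (w j (tau x)) by apply/normsq_neq0_gt0/w_neq0.
pose S := \sum_j b j ^+ 2 * (normsq (w j (tau x)))^-1.
have s0 : 0 < s by rewrite lt_def s_neq0 sumr_ge0// => j _; rewrite sqr_ge0.
have S0 : 0 < S.
  have [j bj] : exists j, b j != 0.
    apply/not_existsP => H; move/eqP: s_neq0; apply; rewrite /s big1// => j _.
    by have /negP := H j; rewrite negbK => /eqP ->; rewrite expr0n.
  rewrite /S (bigD1 j)//= ltr_pwDl//.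
    by rewrite mulr_gt0 ?invr_gt0// lt_def sqr_ge0 sqrf_eq0 bj.
  by rewrite sumr_ge0// => i _; rewrite mulr_ge0 ?sqr_ge0// invr_ge0 ltW.
have q0 : 0 < normsq (q (tau x)).
  by apply: normsq_neq0_gt0; apply/prodf_neq0 => j _; exact: w_neq0.
apply: (@phase_condition R m _ c (rho x ^+ m * normsq (q (tau x)) * (S / (s * rho x)))).
- by rewrite !mulr_gt0 ?exprn_gt0 ?invr_gt0 ?mulr_gt0.
- rewrite /c rmorphXn -exprMn.
  have -> : (Complex 0 1 : R[i]) * conjc (Complex 0 1) = 1.
    by apply/eqP; rewrite eq_complex /=; apply/andP; split; apply/eqP; ring.
  by rewrite expr1n.
- move=> k l.
  have iso := @isotropic_jac_coef R m b sum_b s_neq0 m_ge3 (rho x) (q (tau x))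
    (fun i => (normsq (w i (tau x)))^-1) (fun j => normsq (w j (tau x))) (u (tau x))
    (fun j => w_norm j tx) (fun j => divff (lt0r_neq0 (n_gt0 j))) k l.
  rewrite -[RHS](mulr0 (rho x ^+ 2)) -[X in _ = _ * X]iso.
  rewrite mulr_sumr; apply: eq_bigr => j _.
  rewrite !dz_jacobian_phi// rmorphM mulrACA -normsq_conj normsq_cphi// w_norm//.
  set z := (_ * conjc _).
  by case: z => z1 z2 /=; ring.
- rewrite /Omega.
  have -> : \matrix_(k, j) dz j (row k (Defs.jacobian phi x)) =
      (\matrix_(k, j) jac_coef b (rho x) (q (tau x))
         (fun i => (normsq (w i (tau x)))^-1) k j) *m diag_mx (\row_j cphi x j).
    apply/matrixP => k j; rewrite mxE dz_jacobian_phi// mul_mx_diag !mxE.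
    by rewrite mulrC.
  rewrite det_mulmx det_diag det_jac_coef ?gt_eqF//.
  under eq_bigr do rewrite mxE.
  rewrite prod_cphi -/s -/S -/c !rmorphM /= normsq_conj.
  by ring.
Qed.

End Chart.

(** * Embeddedness *)

Section TorusReduction.
Variable R : realType.

Lemma expi_2pi_int (z : int) : expi (pi *+ 2 * z%:~R : R) = 1.
Proof.
have e2 : expi (pi *+ 2 : R) = 1.
  by rewrite /expi -[pi *+ 2]add0r cosD2pi sinD2pi cos0 sin0.
have enat n : expi (pi *+ 2 * n%:R : R) = 1.
  rewrite mulr_natr; elim: n => [|n IH]; first by rewrite mulr0n expi0.
  by rewrite mulrSr expiD IH e2 mulr1.
case: z => n; first exact: enat.
by rewrite NegzE rmorphN /= mulrN -conj_expi enat conjc1.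
Qed.

(* The integer vectors [nv k] lie in the orthogonal complement of (1,...,1) and
   [a], and every vector [th] of this complement is the combination of the
   [nv k] with coefficients [th k / (a p - a q)]. *)
Lemma torus_bounded_representative (m : nat) (a : 'I_m -> int) :
  (exists p q, a p != a q) ->
  exists2 B : R, 0 <= B & forall th : 'I_m -> R,
    \sum_j th j = 0 -> \sum_j (a j)%:~R * th j = 0 ->
    exists th' : 'I_m -> R,
      [/\ \sum_j th' j = 0, \sum_j (a j)%:~R * th' j = 0,
          forall j, expi (th' j) = expi (th j) & forall j, `|th' j| <= B].
Proof.
move=> [p [q apq]].
pose d : R := (a p - a q)%:~R.
have d0 : d != 0 by rewrite intr_eq0 subr_eq0.
pose nv (k j : 'I_m) : int :=
  (a p - a q) * (j == k)%:R + (a q - a k) * (j == p)%:R + (a k - a p) * (j == q)%:R.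
have sum1 (F : 'I_m -> int) (k : 'I_m) : \sum_j F j * (j == k)%:R = F k.
  rewrite (bigD1 k)//= eqxx mulr1 big1 ?addr0// => j /negbTE ->.
  by rewrite mulr0.
have snv k : \sum_j nv k j = 0.
  rewrite !big_split /= (sum1 (fun=> a p - a q)) (sum1 (fun=> a q - a k)).
  by rewrite (sum1 (fun=> a k - a p)); ring.
have sanv k : \sum_j a j * nv k j = 0.
  under eq_bigr do rewrite !mulrDr !mulrA.
  rewrite !big_split /= (sum1 (fun j => a j * (a p - a q))).
  rewrite (sum1 (fun j => a j * (a q - a k))) (sum1 (fun j => a j * (a k - a p))).
  by ring.
pose B : R := \sum_j \sum_k pi *+ 2 * `|(nv k j)%:~R|.
have pi0 : 0 <= pi *+ 2 :> R by rewrite mulrn_wge0// pi_ge0.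
exists B; first by rewrite sumr_ge0// => j _; rewrite sumr_ge0// => k _; rewrite mulr_ge0.
move=> th sth sath.
(* Coefficients of [th] on the [nv k] in units of 2 pi. Removing their integer parts changes each
   angle by a multiple of 2 pi and leaves coefficients in [0,1), which gives the bound [B]. *)
pose y k : R := th k / (pi *+ 2 * d).
pose f k : int := Num.floor (y k).
have pi2_neq0 : pi *+ 2 != 0 :> R by rewrite gt_eqF// mulrn_wgt0// pi_gt0.
have thE j : th j = \sum_k pi *+ 2 * y k * (nv k j)%:~R.
  have -> : \sum_k pi *+ 2 * y k * (nv k j)%:~R = \sum_k d^-1 * (th k * (nv k j)%:~R).
    apply: eq_bigr => k _; rewrite /y.
    move: (pi *+ 2 : R) pi2_neq0 (d) d0 (th k) ((nv k j)%:~R : R) => P P0 D D0 A N.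
    by field; rewrite P0 D0.
  rewrite -mulr_sumr.
  have -> : \sum_k th k * (nv k j)%:~R = d * th j
      + ((a q)%:~R * \sum_k th k - \sum_k (a k)%:~R * th k) * (j == p)%:R
      + (\sum_k (a k)%:~R * th k - (a p)%:~R * \sum_k th k) * (j == q)%:R.
    have -> : d * th j = \sum_k d * th k * (j == k)%:R.
      rewrite (bigD1 j)//= eqxx mulr1 big1 ?addr0// => k.
      by rewrite eq_sym => /negbTE ->; rewrite mulr0.
    rewrite !mulr_sumr -!sumrB !mulr_suml -!big_split /=; apply: eq_bigr => k _.
    rewrite /nv /d !rmorphD /= !rmorphM /= !rmorphD /= !rmorphN /= !rmorph_nat.
    by ring.
  by rewrite sth sath !mulr0 subrr !mul0r !addr0 mulrA mulVf// mul1r.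
exists (fun j => th j - \sum_k pi *+ 2 * (f k)%:~R * (nv k j)%:~R); split.
- rewrite sumrB sth sub0r exchange_big /= big1 ?oppr0// => k _.
  by rewrite -mulr_sumr -rmorph_sum snv mulr0.
- under eq_bigr do rewrite mulrBr.
  rewrite sumrB sath sub0r; under eq_bigr do rewrite mulr_sumr.
  rewrite exchange_big /= big1 ?oppr0// => k _.
  under eq_bigr do rewrite mulrCA -rmorphM.
  by rewrite -mulr_sumr -rmorph_sum sanv mulr0.
- move=> j; rewrite expiD -[RHS]mulr1; congr (_ * _).
  under eq_bigr do rewrite -mulrA -rmorphM.
  by rewrite -mulr_sumr -rmorph_sum -mulrN -rmorphN expi_2pi_int.
- move=> j; rewrite {1}thE -sumrB (le_trans (ler_norm_sum _ _ _))//.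
  apply: (@le_trans _ _ (\sum_k pi *+ 2 * `|(nv k j)%:~R|)).
    apply: ler_sum => k _; rewrite -mulrBl -mulrBr normrM ler_wpM2r//.
    rewrite normrM ger0_norm// -[leRHS]mulr1 ler_wpM2l//.
    have /andP[f1 f2] := floor_itv (y k); rewrite -/(f k) in f1 f2.
    by rewrite rmorphD /= in f2; rewrite ger0_norm; lra.
  rewrite /B [leRHS](bigD1 j)//= lerDl sumr_ge0// => i _; rewrite sumr_ge0// => k _.
  by rewrite mulr_ge0.
Qed.

End TorusReduction.

(** * Symmetries of equation (A) *)

Section RotatedSolution.
Variables (R : realType) (m : nat) (b : 'I_m -> R).

Lemma is_cderive_shift (f : R -> R[i]) (c t : R) df :
  is_cderive f (t + c) df -> is_cderive (fun x => f (x + c)) t df.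
Proof.
have shift (g : R -> R) dg : is_derive (t + c) 1 g dg ->
    is_derive t 1 (fun x => g (x + c)) dg.
  move=> hg; have hs := @is_derive_shift R t 1 c.
  have := @is_derive1_comp R g (shift c) t dg 1 hg hs.
  by rewrite mulr1.
by move=> [h1 h2]; split; exact: shift.
Qed.

Lemma is_cderive_mulc (f : R -> R[i]) (t : R) (e df : R[i]) :
  is_cderive f t df -> is_cderive (fun x => e * f x) t (e * df).
Proof.
case: e df => e1 e2 [d1 d2] [h1 h2]; split.
  have -> : reF (fun x => Complex e1 e2 * f x) = e1 *: reF f - e2 *: imF f.
    by apply/funext => x; rewrite /reF /imF !fctE; case: (f x).
  exact: (is_deriveB (is_deriveZ e1 h1) (is_deriveZ e2 h2)).
have -> : imF (fun x => Complex e1 e2 * f x) = e1 *: imF f + e2 *: reF f.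
  by apply/funext => x; rewrite /reF /imF !fctE; case: (f x).
exact: (is_deriveD (is_deriveZ e1 h2) (is_deriveZ e2 h1)).
Qed.

(** Since the angles sum to 0, the product over the indices other than [j] acquires the phase e^(-i
    th_j), and conjugation turns it into the phase of component [j]. Time shifts are harmless
    because (A) is autonomous. *)
Lemma rotated_shifted_solution (lo hi lo' hi' c : R) (th : 'I_m -> R)
    (w : 'I_m -> R -> R[i]) :
  \sum_j th j = 0 -> solution_on b lo hi w ->
  (forall t, lo' < t < hi' -> lo < t + c < hi) ->
  solution_on b lo' hi' (fun j t => expi (th j) * w j (t + c)).
Proof.
move=> sth sw sub j t ti.
have -> : vfield b (fun i => expi (th i) * w i (t + c)) j
    = expi (th j) * vfield b (w^~ (t + c)) j.
  rewrite /vfield big_split /= rmorphM mulrCA; congr (_ * _).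
  have -> : \prod_(i < m | i != j) expi (th i) = expi (- th j).
    rewrite -expi_sum; congr expi; apply/eqP; rewrite -addr_eq0 addrC.
    by move: sth; rewrite (bigD1 j)//= => ->.
  by rewrite [LHS]conj_expi opprK.
by apply: is_cderive_mulc; apply: is_cderive_shift; exact/sw/sub.
Qed.

End RotatedSolution.

(** * Points of the image of [phi] close to [phi x0] *)

Section LocalClosedness.
Variables (R : realType) (m : nat) (a : 'I_m -> int) (eps : R).
Let b (j : 'I_m) : R := (a j)%:~R.
Variables (w : 'I_m -> R -> R[i]) (u : R -> R).
Hypothesis m_ge3 : (3 <= m)%N.
Hypothesis a_nonconstant : exists p q, a p != a q.
Hypothesis sum_b : \sum_j b j = 0.
Hypothesis s_neq0 : \sum_j b j ^+ 2 != 0.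
Hypothesis w_sol : solution_on b (- eps) eps w.
Hypothesis w_norm : forall j t, - eps < t < eps -> normsq (w j t) = b j * u t + 1.
Local Notation rho := (@rho R m).
Local Notation tau := (tau b).
Local Notation al := (al b).
Local Notation cphiw := (cphi b w).
Local Notation phiw := (phi b w).
Local Notation dom := (dom b eps).
Local Notation normc := Normc.normc.

(** Summing (C) over [j] cancels [u]: this bounds [w] on the whole interval and lets the norm of
    [phi x] determine [rho x]. *)
Lemma sum_normsq_w t : - eps < t < eps -> \sum_j normsq (w j t) = m%:R.
Proof.
move=> ti; under eq_bigr do rewrite w_norm//.
by rewrite big_split /= -mulr_suml sum_b mul0r add0r sumr_const card_ord.
Qed.

Lemma normc_w_le j t : - eps < t < eps -> normc (w j t) <= m%:R.
Proof.
move=> ti; rewrite -ler_sqr ?nnegrE ?normc_ge0// sqr_normc_normsq.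
apply: (@le_trans _ _ m%:R).
  rewrite -(sum_normsq_w ti) (bigD1 j)//= lerDl sumr_ge0// => i _.
  exact: normsq_ge0.
by rewrite expr2 ler_peMr// ler1n (leq_trans _ m_ge3).
Qed.

Definition sqnorm (v : 'rV[R]_(m + m)) : R := \sum_k v 0 k ^+ 2.

Lemma sqnorm_continuous : continuous sqnorm.
Proof.
move=> v; apply: differentiable_continuous.
have -> : sqnorm = \sum_k ((fun v : 'rV[R]_(m + m) => v 0 k) ^+ 2).
  by apply/funext => x; rewrite fct_sumE.
apply: differentiable_sum => k; apply: differentiableX.
exact: differentiable_coord.
Qed.

Lemma sqnorm_realify (z : 'I_m -> R[i]) : sqnorm (realify z) = \sum_j normsq (z j).
Proof.
rewrite /sqnorm big_split_ord /= -big_split /=; apply: eq_bigr => j _.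
by rewrite realify_lshift realify_rshift.
Qed.

Lemma sqnorm_le (v : 'rV[R]_(m + m)) : sqnorm v <= (m + m)%:R * `|v| ^+ 2.
Proof.
apply: (@le_trans _ _ (\sum_(k < m + m) `|v| ^+ 2)).
  apply: ler_sum => k _; rewrite -real_normK ?num_real//.
  by rewrite lerXn2r ?nnegrE// ler_norm_mxentry.
by rewrite sumr_const card_ord -[leLHS]mulr_natl.
Qed.

Lemma sqnorm_phi x : dom x -> sqnorm (phiw x) = m%:R * rho x ^+ 2.
Proof.
move=> [_ tx]; rewrite sqnorm_realify -(sum_normsq_w tx) mulrC mulr_sumr.
apply: eq_bigr => j _; rewrite /cphi !normsqM normsq_expi mulr1.
by congr (_ * _); rewrite /normsq /= expr0n addr0.
Qed.

(** The three summands of the bound control the components along (1,...,1), [b] and W. The first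
    comes from [sqnorm_phi]: comparison with the sup norm costs a factor root 2, rounded up to 2.
    The last comes from the torus reduction, which does not change [phi]. *)
Lemma bounded_representative (P : R) : exists B : R, forall x, dom x -> `|phiw x| <= P ->
  exists y, [/\ dom y, phiw y = phiw x & `|y| <= B].
Proof.
have [B0 B00 HB] := torus_bounded_representative R a_nonconstant.
pose B1 : R := \sum_j `|b j|.
exists (2 * `|P| + `|eps| * B1 + B0) => x dx Px; have [rho0 tx] := dx.
have s1 : \sum_j al j x = 0 by apply: sum_al.
have s2 : \sum_j b j * al j x = 0 by apply: sum_b_al.
have [th [sth sbth eth thB]] := HB (al^~ x) s1 s2.
exists (chart_point b (rho x) (tau x) th).
have rE : rho (chart_point b (rho x) (tau x) th) = rho x by rewrite rho_point.
have tE : tau (chart_point b (rho x) (tau x) th) = tau x by rewrite tau_point.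
have aE j : al j (chart_point b (rho x) (tau x) th) = th j by rewrite al_point.
split.
- by rewrite /dom /= rE tE.
- rewrite /phi; congr realify; apply/funext => j.
  by rewrite /cphi rE tE aE eth.
have B10 : 0 <= B1 by rewrite sumr_ge0.
apply: rV_norm_le => [|j]; first by rewrite !addr_ge0 ?mulr_ge0.
rewrite mxE (le_trans (ler_normD _ _))// lerD//.
rewrite (le_trans (ler_normD _ _))// lerD//.
  rewrite (ger0_norm (ltW rho0)) -ler_sqr ?nnegrE ?mulr_ge0 ?(ltW rho0)//.
  have mpos : 0 < m%:R :> R by rewrite ltr0n (leq_trans _ m_ge3).
  rewrite -(ler_pM2l mpos) -sqnorm_phi// (le_trans (sqnorm_le _))//.
  have PP : `|phiw x| ^+ 2 <= `|P| ^+ 2.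
    by rewrite lerXn2r ?nnegrE// (le_trans Px)// ler_norm.
  rewrite natrD; have := sqr_ge0 `|P|; nra.
rewrite normrM ler_pM//.
  by move: tx; rewrite ler_norml => /andP[t1 t2]; have := ler_norm eps; lra.
by rewrite /B1 (bigD1 j)//= lerDl sumr_ge0.
Qed.

(** * Cluster points of parameters whose images tend to [phi x0] *)

Section ClusterPoint.
Variables (x0 xs : 'rV[R]_m) (d : R).
Hypothesis d_gt0 : 0 < d.
Hypothesis dom_ball : forall x, `|x - x0| < d -> dom x.
(** The point [xs] itself is not assumed to lie in [dom], since [tau xs] may be an end point of the
    interval. *)
Hypothesis clust : forall A B, nbhs xs A -> nbhs (phiw x0) B ->
  exists x, [/\ dom x, A x & B (phiw x)].

Let dom_x0 : dom x0.
Proof. by apply: dom_ball; rewrite subrr normr0. Qed.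

(** [sqnorm (phi x)] is [m%:R * rho x ^+ 2], and both sides are continuous, the left in [phi x] and
    the right in [x]; so the squares agree. [rho xs] is nonnegative as a limit of positive
    values. *)
Lemma cluster_rho : rho xs = rho x0.
Proof.
have rc : {for xs, continuous (fun x : 'rV[R]_m => m%:R * rho x ^+ 2)}.
  apply: differentiable_continuous; apply: differentiableM => //.
  have : differentiable (rho ^+ 2) xs.
    by apply: differentiableX; exact: differentiable_linform.
  by [].
have mpos : 0 < m%:R :> R by rewrite ltr0n (leq_trans _ m_ge3).
have sqE : m%:R * rho xs ^+ 2 = sqnorm (phiw x0).
  apply/eqP; apply: contraT => neq.
  set e := `|m%:R * rho xs ^+ 2 - sqnorm (phiw x0)| / 2.
  have e0 : 0 < e by rewrite divr_gt0// normr_gt0 subr_eq0.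
  move/cvgrPdist_lt : rc => /(_ e e0) nA.
  move/cvgrPdist_lt : (@sqnorm_continuous (phiw x0)) => /(_ e e0) nB.
  have [x [dx]] := clust nA nB; rewrite (sqnorm_phi dx) => h1 h2.
  have : `|m%:R * rho xs ^+ 2 - sqnorm (phiw x0)| < e + e.
    rewrite -(subrKA (m%:R * rho x ^+ 2)) (le_lt_trans (ler_normD _ _))// ltrD//.
    by rewrite distrC.
  by rewrite -splitr ltxx.
have rs0 : 0 <= rho xs.
  rewrite leNgt; apply/negP => rneg.
  have nA : nbhs xs [set x | rho x < 0].
    apply: (@open_nbhs_nbhs _ xs); split => //.
    have -> : [set x | rho x < 0] = rho @^-1` [set r | r < 0] by [].
    by apply: open_comp => [x _|]; [exact: linform_continuous|exact: open_lt].
  have [x [[r0 _] /= r1 _]] := clust nA filterT.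
  by have := lt_trans r0 r1; rewrite ltxx.
move: sqE; rewrite sqnorm_phi// => /(mulfI (lt0r_neq0 mpos)) /eqP.
by rewrite eqrXn2// ?ltW//; [move=> /eqP|case: dom_x0].
Qed.

(* Gronwall's estimate is applied from times [tau x] with [x] close to [xs] and
   [phi x] close to [phi x0], so no value of [w] at [tau xs] is needed. *)
Lemma cluster_flow j t : - eps < t < eps -> - eps < t + (tau x0 - tau xs) < eps ->
  w j t = expi (al j x0 - al j xs) * w j (t + (tau x0 - tau xs)).
Proof.
set c := tau x0 - tau xs; set th := fun j => al j x0 - al j xs => ti tci.
have sth : \sum_j th j = 0 by rewrite sumrB !sum_al// subr0.
pose y j t := expi (th j) * w j (t + c).
(* The times at which both [w] and its translate [y] are defined. *)
pose lo := Num.max (- eps) (- eps - c); pose hi := Num.min eps (eps - c).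
have lohi t' : (lo < t' < hi) = (- eps < t' < eps) && (- eps < t' + c < eps).
  rewrite /lo /hi gt_max lt_min; apply/idP/idP.
    move=> /andP[/andP[h1 h2] /andP[h3 h4]].
    by apply/andP; split; apply/andP; split => //; lra.
  move=> /andP[/andP[h1 h2] /andP[h3 h4]].
  by apply/andP; split; apply/andP; split => //; lra.
have subI t' : lo < t' < hi -> - eps < t' < eps by rewrite lohi => /andP[].
have subc t' : lo < t' < hi -> - eps < t' + c < eps by rewrite lohi => /andP[].
have solw : solution_on b lo hi w by move=> i t' /subI; exact: w_sol.
have soly : solution_on b lo hi y by apply: (rotated_shifted_solution sth w_sol).
have m1 : 1 <= m%:R :> R by rewrite ler1n (leq_trans _ m_ge3).
have [C HC] := solution_stability b m1.
have wM i t' : lo < t' < hi -> normc (w i t') <= m%:R by move=> /subI; exact: normc_w_le.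
have yM i t' : lo < t' < hi -> normc (y i t') <= m%:R.
  move=> /subc t'c; rewrite /y Normc.normcM normcE_normsq normsq_expi sqrtr1 mul1r.
  exact: normc_w_le.
have {HC} stab := HC lo hi w y solw soly wM yM.
have tlh : lo < t < hi by rewrite lohi ti tci.
suff E0 : sqdist (w^~ t) (y^~ t) = 0 by exact: (sqdist_eq0 E0).
apply/eqP; rewrite eq_le sqdist_ge0 andbT; apply/ler_addgt0Pr => e e0; rewrite add0r.
have rho0 : 0 < rho x0 by case: dom_x0.
(* [K] collects the Gronwall factor for times less than [2 * eps] apart, the lower bound
   [rho x0 / 2] for the radius, the comparison of [sqnorm] with the sup norm, and 4 from two points
   each within [eta] of [phi x0]. *)
pose K : R := expR (`|C| * (2 * eps)) * ((rho x0 / 2) ^- 2 * (m + m)%:R * 4).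
have K0 : 0 < K.
  rewrite /K !mulr_gt0 ?expR_gt0 ?invr_gt0 ?exprn_gt0 ?divr_gt0//.
  by rewrite ltr0n addn_gt0 (leq_trans _ m_ge3).
pose eta : R := Num.min 1 (e / K).
have eta0 : 0 < eta by rewrite lt_min ltr01 divr_gt0.
have Keta : K * eta ^+ 2 <= e.
  have eta1 : eta <= 1 by rewrite ge_min lexx.
  have eta2 : eta <= e / K by rewrite ge_min lexx orbT.
  rewrite -(@ler_pM2r _ K^-1) ?invr_gt0// mulrAC divff ?gt_eqF// mul1r.
  by rewrite (le_trans _ eta2)// expr2 ler_piMr// ltW.
(* The translation takes [xs] to [x0], keeps [rho] and shifts time and angles by [c] and [th]. Hence
   [phi x - phi (sh x)] measures the distance between [w] and [y] at time [tau x], and both images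
   are close to [phi x0]. *)
pose sh x := x + (x0 - xs).
have shE x : sh x - x0 = x - xs by rewrite /sh addrA addrAC addrK.
have cphi0 : {for x0, continuous phiw}.
  exact/differentiable_continuous/(phi_diff w_sol).
move/cvgrPdist_lt : cphi0 => /(_ eta eta0) /nbhs_ballP[d1 d10 hd1].
have nA1 : nbhs xs (ball xs (Num.min d d1)) by apply: nbhsx_ballx; rewrite lt_min d_gt0.
have nA2 : nbhs xs [set x | rho x0 / 2 < rho x].
  have := @linform_continuous R m (fun=> m%:R^-1) xs.
  move/cvgrPdist_lt => /(_ (rho x0 / 2)); rewrite divr_gt0// => /(_ isT).
  apply: filterS => x /=; rewrite -!/(rho _) cluster_rho ltr_norml => /andP[_ h].
  by lra.
have nB : nbhs (phiw x0) (ball (phiw x0) eta) by exact: nbhsx_ballx.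
have [x [dx [Ax1 /= Ax2] Bx]] := clust (filterI nA1 nA2) nB.
rewrite -ball_normE /ball_ /= lt_min distrC in Ax1; case/andP: Ax1 => xd xd1.
rewrite -ball_normE /ball_ /= in Bx.
have dsh : dom (sh x) by apply: dom_ball; rewrite shE.
have hsh : `|phiw x0 - phiw (sh x)| < eta.
  by apply: hd1; rewrite -ball_normE /ball_ /= distrC shE.
have [rx tx] := dx.
have tsh : tau (sh x) = tau x + c by rewrite /sh /tau linformD linformD linformN.
have rsh : rho (sh x) = rho x.
  by rewrite /sh {1}/rho linformD linformD linformN -!/(rho _) cluster_rho subrr addr0.
have ash i : al i (sh x) = al i x + th i by rewrite /sh /al linformD linformD linformN.
have txlh : lo < tau x < hi by rewrite lohi tx -tsh; case: dsh.
have dist : rho x ^+ 2 * sqdist (w^~ (tau x)) (y^~ (tau x)) = sqnorm (phiw x - phiw (sh x)).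
  have -> : phiw x - phiw (sh x) = realify (fun i => cphiw x i - cphiw (sh x) i).
    apply/rowP => i; rewrite !mxE; case: (fintype.split i) => k /=.
      by case: (cphiw x k) => ? ?; case: (cphiw (sh x) k).
    by case: (cphiw x k) => ? ?; case: (cphiw (sh x) k).
  rewrite sqnorm_realify /sqdist mulr_sumr; apply: eq_bigr => i _.
  have -> : cphiw x i - cphiw (sh x) i =
      ((rho x)%:C)%C * expi (al i x) * (w i (tau x) - y i (tau x)).
    by rewrite /cphi rsh ash tsh expiD /y; ring.
  rewrite !normsqM normsq_expi mulr1; congr (_ * _).
  by rewrite /normsq /= expr0n addr0.
rewrite (le_trans (stab t (tau x) tlh txlh))// (le_trans _ Keta)// /K -mulrA.
apply: ler_pM; rewrite ?expR_ge0 ?sqdist_ge0//.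
  rewrite ler_expR (@le_trans _ _ (`|C| * `|t - tau x|)) ?ler_wpM2r ?ler_norm//.
  rewrite ler_wpM2l// ler_norml.
  by case/andP: ti => h1 h2; case/andP: tx => h3 h4; apply/andP; split; lra.
rewrite -!mulrA mulrC ler_pdivlMr ?exprn_gt0 ?divr_gt0//.
apply: (@le_trans _ _ (rho x ^+ 2 * sqdist (w^~ (tau x)) (y^~ (tau x)))).
  rewrite mulrC ler_wpM2r ?sqdist_ge0// lerXn2r ?nnegrE ?divr_ge0// ?ltW//.
rewrite dist (le_trans (sqnorm_le _))// ler_wpM2l//.
have nle : `|phiw x - phiw (sh x)| <= 2 * eta.
  rewrite -(subrKA (phiw x0)) (le_trans (ler_normD _ _))//.
  by rewrite mulr_natl mulr2n lerD// ?ltW// distrC.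
have -> : 4 * eta ^+ 2 = (2 * eta) ^+ 2 by ring.
by rewrite lerXn2r ?nnegrE ?mulr_ge0// ltW.
Qed.

(** Take [y = x + (x0 - xs)]: the radius is unchanged, and by [cluster_flow] the change of angles
    compensates the shift in time. *)
Lemma cluster_translate x : dom x -> `|x - xs| < d ->
  exists2 y, `|y - x0| < d & phiw y = phiw x.
Proof.
move=> [rx tx] xd; pose y := x + (x0 - xs).
have yE : y - x0 = x - xs by rewrite /y addrA addrAC addrK.
exists y; first by rewrite yE.
have [ry ty] : dom y by apply: dom_ball; rewrite yE.
have tyE : tau y = tau x + (tau x0 - tau xs) by rewrite /y /tau linformD linformD linformN.
have ryE : rho y = rho x.
  by rewrite /y {1}/rho linformD linformD linformN -!/(rho _) cluster_rho subrr addr0.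
have ayE i : al i y = al i x + (al i x0 - al i xs).
  by rewrite /y /al linformD linformD linformN.
rewrite /phi; congr realify; apply/funext => j.
rewrite /cphi ryE tyE ayE (cluster_flow j tx) -?tyE//.
by rewrite expiD !mulrA.
Qed.

End ClusterPoint.

(** It suffices to treat the compact ball [K] of bounded representatives. Near each [xs] in [K],
    either the cluster property holds and [cluster_translate] applies, or [phi] stays at a positive
    distance from [phi x0]; compactness makes [eta] uniform. *)
Lemma local_closedness x0 d : 0 < d -> (forall x, `|x - x0| < d -> dom x) ->
  exists2 eta : R, 0 < eta & forall x, dom x -> `|phiw x - phiw x0| < eta ->
    exists2 y, `|y - x0| < d & phiw y = phiw x.
Proof.
move=> d0 domd; have [B HB] := bounded_representative (`|phiw x0| + 1).
pose K := [set x : 'rV[R]_m | `|x| <= B].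
have cK : compact K.
  apply: bounded_closed_compact.
    exists B; split; first exact: num_real.
    by move=> M BM x /= /le_trans; apply; exact: ltW.
  have -> : K = (fun x : 'rV[R]_m => `|x|) @^-1` [set r | r <= B] by [].
  apply: closed_comp => [x _|]; last exact: closed_le.
  exact: norm_continuous.
pose P (eta : R) (x : 'rV[R]_m) := dom x -> `|phiw x - phiw x0| < eta ->
    exists2 y, `|y - x0| < d & phiw y = phiw x.
have near_K : \forall eta \near 0^'+, K `<=` P eta.
  apply: (iffLR (compact_near_coveringP K) cK) => xs _.
  have [clust|] := pselect (forall A B, nbhs xs A -> nbhs (phiw x0) B ->
      exists x, [/\ dom x, A x & B (phiw x)]).
    exists (ball xs d, setT) => /=.
      by split; [exact: nbhsx_ballx | exact: filterT].
    move=> [x eta] [/= xd _] dx _.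
    apply: (cluster_translate d0 domd clust dx).
    by move: xd; rewrite -ball_normE /ball_ /= distrC.
  move=> /existsNP[A /existsNP[C]] /not_implyP[nA /not_implyP[nC noX]].
  have /nbhs_ballP[e e0 eC] := nC.
  exists (A, [set eta | eta < e]) => /=.
    by split => //; exact: nbhs_right_lt.
  move=> [x eta] [/= Ax etae] dx xeta; exfalso; apply: noX; exists x; split => //.
  apply: eC; rewrite -ball_normE /ball_ /= distrC.
  exact: lt_trans xeta etae.
have : \forall eta \near 0^'+, [/\ 0 < eta, eta < 1 & K `<=` P eta].
  near=> eta; split; near: eta.
  - exact: nbhs_right_gt.
  - exact: nbhs_right_lt.
  - exact: near_K.
move=> /filter_ex[eta [eta0 eta1 HK]]; exists eta => // x dx xeta.
(* [eta < 1] places [phi x] within the bound for which [B] was chosen. *)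
have [|y [dy yx yB]] := HB x dx.
  rewrite -(subrK (phiw x0) (phiw x)) (le_trans (ler_normD _ _))// addrC lerD//.
  by rewrite ltW// (lt_trans xeta).
rewrite -yx; apply: HK => //; first by rewrite yx.
Unshelve. all: by end_near. Qed.

End LocalClosedness.

Lemma near_dist_lt (R : realType) (T : topologicalType) (V : normedModType R)
    (f : T -> V) (x : T) (c : V) (e : R) :
  {for x, continuous f} -> `|f x - c| < e -> \forall y \near x, `|f y - c| < e.
Proof.
move=> cf fe; have e0 : 0 < e - `|f x - c| by rewrite subr_gt0.
move/cvgrPdistC_lt : cf => /(_ _ e0); apply: filterS => y fy.
by rewrite -(subrKA (f x)) (le_lt_trans (ler_normD _ _))// -ltrBrDr.
Qed.

(** * The conserved quantities and the charts of N *)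

Section SpecialLagrangian.
Variables (R : realType) (m : nat) (a : 'I_m -> int) (eps : R).
Variables (w : 'I_m -> R -> R[i]) (u : R -> R).
Let b (j : 'I_m) : R := (a j)%:~R.

Lemma odeA_solution :
  (forall j t, - eps < t < eps -> cdifferentiable (w j) t) ->
  (forall t, - eps < t < eps -> odeA a w t) -> solution_on b (- eps) eps w.
Proof.
move=> dw hA j t ti; have [d1 d2] := dw j t ti.
have <- : cderive (w j) t = vfield b (w^~ t) j.
  by rewrite hA// /vfield rmorph_int.
by split; apply: DeriveDef => //; rewrite /cderive /= derive1E.
Qed.

(** By (A) and (B), |w_j|^2 and [b j * u] both have derivative 2 a_j Re(w_1 ... w_m). *)
Lemma normsq_w_sub_constant j :
  solution_on b (- eps) eps w ->
  (forall t, - eps < t < eps -> derivable u t 1) ->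
  (forall t, - eps < t < eps -> odeB w u t) ->
  forall s t, - eps < s < eps -> - eps < t < eps ->
  normsq (w j s) - b j * u s = normsq (w j t) - b j * u t.
Proof.
move=> sw du hB; apply: (@derive0_constant R (- eps) eps
  (fun t => normsq (w j t) - b j * u t)) => t ti.
have [h1 h2] := sw j t ti.
have hu : is_derive t 1 u (2 * complex.Re (\prod_(k < m) w k t)).
  by rewrite -(hB t ti); apply: DeriveDef; [exact: du | rewrite derive1E].
have -> : (fun t => normsq (w j t) - b j * u t) =
    reF (w j) ^+ 2 + imF (w j) ^+ 2 - b j *: u by apply/funext.
apply: is_derive_eq; rewrite (bigD1 j)//= /vfield /reF /imF /GRing.scale /=.
case: (w j t) => x y; case: (\prod_(k < m | k != j) w k t) => p q /=.
by ring.
Qed.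

Lemma Nset_image : \sum_j b j = 0 -> \sum_j b j ^+ 2 != 0 -> (3 <= m)%N ->
  Nset a eps w = phi b w @` dom b eps.
Proof.
move=> sb s0 m3; apply/seteqP; split=> p.
  move=> [r [t [th [r0 ti sth sath ->]]]].
  have rE := rho_point m3 sb r t sth.
  have tE := tau_point sb s0 r t sath.
  exists (chart_point b r t th); first by rewrite /dom /= rE tE.
  rewrite /phi; congr realify; apply/funext => j.
  by rewrite /cphi rE tE al_point.
move=> [x [r0 tx] <-]; exists (rho x), (tau b x), ((al b)^~ x); split => //.
  exact: sum_al.
exact: sum_b_al.
Qed.

(** The chart is [phi] on the ball from [immersion_lower_bound], cut down to points with image
    within [eta] of [phi x0]. The lower bound gives injectivity and a continuous inverse;
    [local_closedness] shows that no other sheet of N enters the ball around [phi x0]. *)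
Lemma special_lagrangian_Nset :
  (3 <= m)%N -> (exists p q, a p != a q) -> \sum_j b j = 0 -> \sum_j b j ^+ 2 != 0 ->
  (forall j t, - eps < t < eps -> w j t != 0) ->
  solution_on b (- eps) eps w ->
  (forall j t, - eps < t < eps -> normsq (w j t) = b j * u t + 1) ->
  special_lagrangian ((Complex 0 1 : R[i]) ^+ (m - 2)) (Nset a eps w).
Proof.
move=> m3 apq sb s0 w0 sw wn p; rewrite Nset_image// => -[x0 dx0 <-{p}].
have cal x (dx : dom b eps x) := phi_calibrated m3 sb s0 w0 sw wn dx.
have [d [c [d0 c0 domd low]]] := immersion_lower_bound (open_dom (b:=b) (eps:=eps)) dx0
  (phi_diff sw) (fun i => phi_derive_continuous sw dx0) (cal x0 dx0).1.
have [eta eta0 closed_eta] := local_closedness m3 apq sb s0 sw wn d0 domd.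
exists (ball (phi b w x0) eta), [set x | `|x - x0| < d /\ `|phi b w x - phi b w x0| < eta],
  (phi b w); split.
- exact: ballxx.
- split; last first.
    split; first by move=> l x [/domd dx _]; exact: (phi_smooth sw l dx).
    by move=> x [/domd dx _]; exact: (cal x dx).1.
  split.
  + exact: ball_open.
  + rewrite openE => x [xd xeta] /=.
    have n1 : \forall y \near x, `|y - x0| < d.
      by apply: (@near_dist_lt R _ _ id) => //; exact: cvg_id.
    have n2 : \forall y \near x, `|phi b w y - phi b w x0| < eta.
      apply: near_dist_lt => //.
      exact/differentiable_continuous/(phi_diff sw)/domd.
    by apply: filterS2 n1 n2 => y; split.
  + apply/seteqP; split=> z.
      move=> [x [xd xeta] <-]; split; first by exists x => //; exact: domd.
      by rewrite -ball_normE /ball_ /= distrC.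
    move=> [[x dx <-]]; rewrite -ball_normE /ball_ /= distrC => xeta.
    have [y yd yx] := closed_eta x dx xeta.
    by exists y => //; split => //; rewrite yx.
  + move=> x y [xd _] [yd _] xy.
    have := low y x yd xd; rewrite xy subrr normr0 mulr0 normr_le0 subr_eq0.
    by move=> /eqP.
  + move=> x [xd _] e e0; exists (e / c); first by rewrite divr_gt0.
    move=> y [yd _] yx; rewrite (le_lt_trans (low x y xd yd))//.
    by rewrite mulrC -ltr_pdivlMr.
- by move=> x [/domd dx _]; exact: (cal x dx).2.
Qed.

End SpecialLagrangian.

Theorem theorem7p1 (R : realType) (m : nat) (a : 'I_m -> int) (eps : R)
    (w : 'I_m -> R -> R[i]) (u : R -> R) :
  (3 <= m)%N ->
  (forall i j : 'I_m, (i <= j)%N -> a i <= a j) ->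
  (exists j : 'I_m, a j != 0) ->
  \big[gcdn/0%N]_(j < m) absz (a j) = 1%N ->
  \sum_(j < m) a j = 0 ->
  0 < eps ->
  (forall (j : 'I_m) (t : R), - eps < t < eps -> w j t != 0) ->
  (forall (j : 'I_m) (t : R), - eps < t < eps -> cdifferentiable (w j) t) ->
  (forall t : R, - eps < t < eps -> derivable u t 1) ->
  (* (i) *)
  (((forall t : R, - eps < t < eps -> odeA a w t) ->
    (forall t : R, - eps < t < eps -> odeB w u t) ->
    constrC a w u 0 ->
    forall t : R, - eps < t < eps -> constrC a w u t)
  /\
  (* (ii) *)
   ((forall t : R, - eps < t < eps -> odeA a w t) ->
    (forall t : R, - eps < t < eps -> odeB w u t) ->
    (forall t : R, - eps < t < eps -> constrC a w u t) ->
    special_lagrangian ((Complex 0 1 : R[i]) ^+ (m - 2)) (Nset a eps w))).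
Proof.
move=> m3 _ [k ak0] _ sa eps0 w0 dw du; split=> [hA hB hC0 t ti j|hA hB hC].
  have i0 : - eps < 0 < eps by rewrite oppr_lt0 eps0.
  have := normsq_w_sub_constant j (odeA_solution dw hA) du hB ti i0.
  by rewrite -!sqr_normc_normsq hC0; lra.
apply: (special_lagrangian_Nset (u := u)) => //.
(* If all [a j] were equal, their zero sum would force [a k] to be 0. *)
- apply: contrapT => nc.
  have aE j : a j = a k.
    by apply/eqP; apply: contrapT => /negP ajk; apply: nc; exists j, k.
  move/eqP: sa; rewrite (eq_bigr _ (fun j _ => aE j)) sumr_const card_ord.
  rewrite -mulr_natr mulf_eq0 (negbTE ak0) /= pnatr_eq0.
  by move=> /eqP m0; rewrite m0 in m3.
- by rewrite -rmorph_sum sa.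
- rewrite psumr_eq0 => [|j _]; last exact: sqr_ge0.
  apply/negP => /allP /(_ k (mem_index_enum k)).
  by rewrite sqrf_eq0 intr_eq0 (negbTE ak0).
- exact: odeA_solution.
- by move=> j t ti; rewrite -sqr_normc_normsq hC.
Qed.
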